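(* Suppose $X$ is recurrent and $A$ is a PCAF with $\mu_A((\ell,r))>0$. Then $P^x(A_\infty=\infty)=1$. Consider $g=c_1\psi_A+c_2\phi_A$, where $\phi_A$ and $\psi_A$ are respectively the nonincreasing and nondecreasing fundamental solutions associated with $A$, $c_i\ge0$ and $c_1+c_2>0$. Let $(Q^x)_{x\in(\ell,r)}$ denote the family of measures obtained from $(P^x)$ by the path transformation via $(g,A)$. Then $X$ is transient under $(Q^x)_{x\in(\ell,r)}$. Moreover: (1) If $c_1=0$, then $Q^x(X_{\zeta-}=\ell)=1$. (2) If $c_2=0$, then $Q^x(X_{\zeta-}=r)=1$. (3) If $c_1$ and $c_2$ are non-zero, then $Q^x(X_{\zeta-}=r)>0$ and $Q^x(X_{\zeta-}=\ell)>0$.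
   Context: Let $-\infty\le\ell<r\le\infty$ and let $X=(\Omega,\mathcal F,\mathcal F_t,X_t,\theta_t,P^x)$ be a regular one-dimensional diffusion on $(\ell,r)$ with no killing inside $(\ell,r)$ and absorbing boundaries, lifetime $\zeta=\inf\{t>0:X_t\in\{\ell,r\}\}$, strictly increasing continuous scale function $s$ (extended to $\ell,r$ by limits) and speed measure $m$, with generator $\frac{d}{dm}\frac{d}{ds}$. $\mathcal F^u$ is the $\sigma$-algebra generated by the maps $f(X_t)$, $t\ge0$, $f$ universally measurable. A positive continuous additive functional (PCAF) $A$ is an adapted $[0,\infty]$-valued family, a.s. nondecreasing and finite continuous on $[0,\zeta)$, with $A_t=A_{\zeta-}$ for $t\ge\zeta$ and $A_{t+s}=A_t+A_s\circ\theta_t$ a.s.; its Revuz measure is defined by $\int f\,d\mu_A=\lim_{t\to0}t^{-1}\int_\ell^rE^x[\int_0^tf(X_u)dA_u]m(dx)$. Fundamental solutions: $\psi_A$ is a non-negative, nondecreasing, nonconstant solution of $g(x)=a+\kappa(s(x)-s(\ell))+\int_\ell^r(s(x)-s(y))^+g(y)\mu_A(dy)$, and $\phi_A$ a non-negative, nonincreasing, nonconstant solution of $g(x)=a+\kappa(s(r)-s(x))+\int_\ell^r(s(y)-s(x))^+g(y)\mu_A(dy)$, for some $a,\kappa\ge0$ with $\kappa=0$ in the first (resp. second) equation if $s(\ell)=-\infty$ (resp. $s(r)=\infty$), $0\times\infty=0$; such solutions exist. Path transformation: $g(X)\exp(-A)$ is a $P^x$-local martingale for all $x$, and $(Q^x)$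 is the unique family of measures on $(\Omega,\mathcal F^u)$ rendering $X$ Markov with $Q^x(X_0=x)=1$ and $Q^x(F,T<\zeta)=E^x[\mathbf 1_F\mathbf 1_{[T<\zeta]}g(X_T)\exp(-A_T)]/g(x)$ for every stopping time $T$ and $F\in\mathcal F_T$; under $(Q^x)$, $X$ is a regular diffusion on $(\ell,r)$ without killing, with scale function $s_g(dx)=g^{-2}(x)s(dx)$ and speed measure $m_g(dx)=g^2(x)m(dx)$. *)

(* Defs.v *)
From HB Require Import structures.
From mathcomp Require Import all_boot all_order all_algebra.
From mathcomp Require Import all_classical all_reals all_analysis.
From mathcomp Require Import measurable_realfun.
Set Implicit Arguments.
Unset Strict Implicit.
Unset Printing Implicit Defensive.
Import Order.TTheory GRing.Theory Num.Theory.
Import numFieldNormedType.Exports.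
Local Open Scope classical_set_scope.
Local Open Scope ring_scope.
Local Open Scope ereal_scope.

(* Conventions.  Times are reals t >= 0; states are points of \bar R, the state
   space being `[l, r] with interior `]l, r[, which consists of finite reals
   only.  Random times take values in \bar R.  Functions of the state and
   measures on the state space are only ever used on `]l, r[.
   The integral of the library is defined for every nonnegative function, as a
   lower integral; on functions that are measurable only up to a null set (such
   as universally measurable ones) it is the integral for the completion. *)

Section universal_measurability.
Context {R : realType}.

Definition umeasurable (B : set (\bar R)) :=
  forall mu : {finite_measure set (\bar R) -> \bar R},
  exists C D : set (\bar R),
    [/\ measurable C, measurable D, C `<=` B, B `<=` D & mu (D `\` C) = 0].

Definition umeasurable_fun (D : set (\bar R)) (f : \bar R -> \bar R) :=
  forall B : set (\bar R), measurable B -> umeasurable (D `&` f @^-1` B).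

End universal_measurability.

Section fundamental_solutions.
Context {R : realType} (l r : \bar R).

Notation I := (`]l, r[%classic : set (\bar R)).

(* the extension of s to a boundary point b *)
Definition scale_bnd (s : \bar R -> R) (b : \bar R) : \bar R :=
  lim ((s y)%:E @[y --> within I (nbhs b)]).

(* The library's 0 * +oo = 0 matters for kappa = 0 and an infinite boundary
   value of s. *)
Definition fundamental_incr (s : \bar R -> R)
    (mu : {measure set (\bar R) -> \bar R}) (g : \bar R -> R) :=
  [/\ forall x, I x -> (0 <= g x)%R,
      {in I &, {homo g : x y / (x <= y)%E >-> (x <= y)%R}},
      exists x y, [/\ I x, I y & g x <> g y] &
      exists a kappa : R, [/\ (0 <= a)%R, (0 <= kappa)%R,
        scale_bnd s l = -oo -> kappa = 0%R &
        forall x, I x -> (g x)%:E =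
          a%:E + kappa%:E * ((s x)%:E - scale_bnd s l) +
          \int[mu]_(y in I) (Num.max (s x - s y) 0 * g y)%:E]].

Definition fundamental_decr (s : \bar R -> R)
    (mu : {measure set (\bar R) -> \bar R}) (g : \bar R -> R) :=
  [/\ forall x, I x -> (0 <= g x)%R,
      {in I &, {homo g : x y / (x <= y)%E >-> (y <= x)%R}},
      exists x y, [/\ I x, I y & g x <> g y] &
      exists a kappa : R, [/\ (0 <= a)%R, (0 <= kappa)%R,
        scale_bnd s r = +oo -> kappa = 0%R &
        forall x, I x -> (g x)%:E =
          a%:E + kappa%:E * (scale_bnd s r - (s x)%:E) +
          \int[mu]_(y in I) (Num.max (s y - s x) 0 * g y)%:E]].

End fundamental_solutions.

Section processes.
Context {R : realType} {d : measure_display} {Om : measurableType d}.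
Implicit Types (X : R -> Om -> \bar R) (F : R -> set (set Om)).
Implicit Types (T : Om -> \bar R) (l r : \bar R).

Definition observables X (J : set R) : set (set Om) :=
  [set C | exists t (f : \bar R -> \bar R) (B : set (\bar R)),
    [/\ J t, umeasurable_fun setT f, measurable B & C = (f \o X t) @^-1` B]].

(* right-continuous version of the filtration generated by F^u up to time t *)
Definition natural_filtration X (t : R) : set (set Om) :=
  \bigcap_(u in [set u : R | (t < u)%R]) <<s observables X `[0%R, u] >>.

Definition stopping_time F T :=
  (forall w, 0 <= T w) /\
  (forall t : R, (0 <= t)%R -> F t [set w | T w <= t%:E]).

Definition stopped_sigma F T : set (set Om) :=
  [set C | <<s \bigcup_(t in `[0%R, +oo[) F t >> C /\
    forall t : R, (0 <= t)%R -> F t (C `&` [set w | T w <= t%:E])].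

Definition first_time X (D : set (\bar R)) (w : Om) : \bar R :=
  ereal_inf [set t%:E | t in [set t : R | (0 < t)%R /\ D (X t w)]].

Definition hit X (y : \bar R) : Om -> \bar R := first_time X [set y].

Definition lifetime l r X : Om -> \bar R := first_time X [set l; r].

(* the filter of the times u < z converging to z, where z may be +oo *)
Definition before (z : \bar R) : set_system (\bar R) :=
  within `[0, z[%classic (nbhs z).

(* the event that the left limit of X at its lifetime exists and equals b *)
Definition exits_at l r X (b : \bar R) : set Om :=
  [set w | X (fine u) w @[u --> before (lifetime l r X w)] --> b].

End processes.

(* the sample space with the sigma-algebra F^u generated by the f(X_t), f
   universally measurable *)
Notation path_algebra X :=
  (g_sigma_algebraType (observables X `[0%R, +oo[%classic)).

(* Absence of killing inside `]l, r[ is built in: a path is continuous in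
   `[l, r], and l and r are its only absorbing points. *)
Record diffusion (R : realType) (l r : \bar R) (d : measure_display)
    (Om : measurableType d) := Diffusion {
  path :> R -> Om -> \bar R ;
  filt : R -> set (set Om) ;
  shift : R -> Om -> Om ;
  law : \bar R -> probability Om R ;
  path_range : forall t w, (0 <= t)%R -> l <= path t w <= r ;
  path_continuous : forall w, {within `[0%R, +oo[, continuous (path ^~ w)} ;
  path_absorbed : forall s t w, (0 <= s <= t)%R ->
    [set l; r] (path s w) -> path t w = path s w ;
  filt_sigma_algebra : forall t, (0 <= t)%R ->
    sigma_algebra [set: Om] (filt t) /\ filt t `<=` measurable ;
  filt_homo : forall s t, (0 <= s <= t)%R -> filt s `<=` filt t ;
  filt_right_continuous : forall t, (0 <= t)%R ->
    \bigcap_(u in [set u : R | (t < u)%R]) filt u `<=` filt t ;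
  path_adapted : forall t, (0 <= t)%R -> observables path `[0%R, t] `<=` filt t ;
  path_shift : forall s t w, (0 <= s)%R -> (0 <= t)%R ->
    path t (shift s w) = path (s + t) w ;
  law_start : forall x, `]l, r[%classic x ->
    law x [set w | path 0 w = x] = 1 ;
  law_umeasurable : forall C, measurable C ->
    umeasurable_fun `]l, r[ (fun x => law x C) ;
  strong_markov : forall T C, stopping_time filt T -> measurable C ->
    let live := [set w | T w < lifetime l r path w] in
    let shifted := [set w | C (shift (fine (T w)) w)] in
    measurable (live `&` shifted) /\
    forall x G, `]l, r[%classic x -> stopped_sigma filt T G ->
      law x (G `&` (live `&` shifted)) =
      \int[law x]_(w in G `&` live) law (path (fine (T w)) w) C ;
  regular : forall x y, `]l, r[%classic x -> `]l, r[%classic y ->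
    0 < law x [set w | hit path y w < +oo] }.

Section diffusions.
Context {R : realType} {l r : \bar R} {d : measure_display}.
Context {Om : measurableType d} (X : diffusion l r Om).

Notation I := (`]l, r[%classic : set (\bar R)).
Notation zeta := (lifetime l r X).

Definition is_scale (s : \bar R -> R) :=
  [/\ {within I, continuous s},
      {in I &, {homo s : x y / (x < y)%E >-> (x < y)%R}} &
      forall a x b, l < a -> a < x -> x < b -> b < r ->
        law X x [set w | hit X b w < hit X a w] =
        ((s x - s a) / (s b - s a))%:E].

(* Without a factor 2: this is the normalization for which the generator is
   d/dm d/ds (Revuz and Yor, chapter VII, section 3). *)
Definition is_speed (s : \bar R -> R)
    (m : {measure set (\bar R) -> \bar R}) :=
  (forall a b, l < a -> a <= b -> b < r -> m `[a, b]%classic < +oo) /\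
  (forall a x b, l < a -> a < x -> x < b -> b < r ->
    \int[law X x]_w Order.min (hit X a w) (hit X b w) =
    \int[m]_(y in `]a, b[) ((s (Order.min x y) - s a) *
      (s b - s (Order.max x y)) / (s b - s a))%:E).

(* Recurrence is a property of a family of laws on the paths, so that it applies
   both to (P^x) and to its path transformation; a regular diffusion is transient
   when it is not recurrent. *)
Definition recurrent (P : \bar R -> set Om -> \bar R) :=
  forall x y, I x -> I y -> P x [set w | hit X y w < +oo] = 1.

Definition transient (P : \bar R -> set Om -> \bar R) := ~ recurrent P.

Definition pcaf_path (a : R -> \bar R) (z : \bar R) :=
  [/\ forall s t : R, (0 <= s <= t)%R -> a s <= a t,
      forall t : R, (0 <= t)%R -> t%:E < z -> a t \is a fin_num,
      {within [set t : R | (0 <= t)%R /\ t%:E < z], continuous a} &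
      forall t : R, (0 <= t)%R -> z <= t%:E ->
        a (fine u) @[u --> before z] --> a t].

Definition pcaf (A : R -> Om -> \bar R) :=
  [/\ forall t w, (0 <= t)%R -> 0 <= A t w,
      forall t B, (0 <= t)%R -> measurable B -> filt X t (A t @^-1` B),
      forall x, I x -> {ae law X x, forall w, pcaf_path (A ^~ w) (zeta w)} &
      forall x s t, I x -> (0 <= s)%R -> (0 <= t)%R ->
        {ae law X x, forall w, A (t + s)%R w = A t w + A s (shift X t w)}].

Definition is_stieltjes (a : R -> \bar R) (z : \bar R)
    (nu : {measure set (measurableTypeR R) -> \bar R}) :=
  (forall s t : R, (0 <= s <= t)%R -> t%:E < z -> nu `]s, t]%classic = a t - a s) /\
  nu (~` [set t : R | (0 < t)%R /\ t%:E < z]) = 0.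

(* The Lebesgue-Stieltjes measure d(a t) on the times 0 < t < z: these conditions
   determine it on Borel sets and, when a satisfies pcaf_path, it exists. *)
Definition stieltjes (a : R -> \bar R) (z : \bar R) :
    {measure set (measurableTypeR R) -> \bar R} :=
  match pselect (exists nu, is_stieltjes a z nu) with
  | left nuP => projT1 (cid nuP)
  | right _ => mzero
  end.

Definition revuz (m : {measure set (\bar R) -> \bar R})
    (A : R -> Om -> \bar R) (mu : {measure set (\bar R) -> \bar R}) :=
  forall f : \bar R -> \bar R, measurable_fun I f -> (forall x, I x -> 0 <= f x) ->
  (t^-1)%:E * \int[m]_(x in I) \int[law X x]_w
    \int[stieltjes (A ^~ w) (zeta w)]_(u in
      [set u : R | (0 < u <= t)%R /\ u%:E < zeta w]) f (X u w)
  @[t --> (0:R)^'+] --> \int[mu]_(x in I) f x.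

(* Local martingale on [0, zeta): M is only read before the lifetime. *)
Definition local_martingale (M : R -> Om -> \bar R) :=
  (forall (t : R) B, (0 <= t)%R -> measurable B ->
    filt X t ([set w | t%:E < zeta w] `&` M t @^-1` B)) /\
  (forall x, I x -> exists T : nat -> Om -> \bar R,
    [/\ forall n, stopping_time (filt X) (T n),
        {ae law X x, forall w, [/\ forall n, T n w <= T n.+1 w,
          forall n, T n w < zeta w & T ^~ w @ \oo --> zeta w]} &
        forall n, let stopped t w := M (fine (Order.min t%:E (T n w))) w in
          (forall t : R, (0 <= t)%R ->
            \int[law X x]_w `|stopped t w| < +oo) /\
          (forall (s t : R) G, (0 <= s <= t)%R -> filt X s G ->
            \int[law X x]_(w in G) stopped t w =
            \int[law X x]_(w in G) stopped s w)]).

Definition markov_family (Q : \bar R -> probability (path_algebra X) R) :=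
  (forall t B, (0 <= t)%R -> measurable B ->
    umeasurable_fun I (fun x => Q x (X t @^-1` B))) /\
  (forall x s t B G, I x -> (0 <= s)%R -> (0 <= t)%R -> measurable B ->
    natural_filtration X t G ->
    let live := [set w | t%:E < zeta w] in
    Q x (G `&` live `&` X (t + s)%R @^-1` B) =
    \int[Q x]_(w in G `&` live) Q (X t w) (X s @^-1` B)).

(* The stopping times are those of the filtration generated by X, not completed:
   an event of F^u that is null for every P^x may well have positive Q^x-measure
   (for X recurrent, convergence of X to a boundary point), and the formula below,
   read at T = 0, would fail if such null events belonged to the filtration.
   The formula determines the family (Q^x) uniquely, as seen by taking T
   constant. *)
Definition path_transformation (g : \bar R -> R) (A : R -> Om -> \bar R)
    (Q : \bar R -> probability (path_algebra X) R) :=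
  let M t w := (g (X t w))%:E * expeR (- A t w) in
  [/\ local_martingale M,
      markov_family Q,
      forall x, I x -> Q x [set w | X 0%R w = x] = 1 &
      forall x T C, I x -> stopping_time (natural_filtration X) T ->
        stopped_sigma (natural_filtration X) T C ->
        let live := [set w | T w < zeta w] in
        Q x (C `&` live) =
        (\int[law X x]_(w in C `&` live) M (fine (T w)) w) * ((g x)^-1)%:E].

End diffusions.

(* Main.v *)
From HB Require Import structures.
Require Import Defs.
From mathcomp Require Import all_boot all_order all_algebra.
From mathcomp Require Import all_classical all_reals all_analysis.
From mathcomp Require Import measurable_realfun.
From mathcomp Require Import lra.
Import Order.TTheory GRing.Theory Num.Theory.
Import numFieldNormedType.Exports.
Set Implicit Arguments.
Unset Strict Implicit.
Unset Printing Implicit Defensive.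
Local Open Scope classical_set_scope.
Local Open Scope ring_scope.
Local Open Scope ereal_scope.

(** Write E^x for the expectation under [law X x], T_y for the first time at
which X visits y, and zeta for the lifetime.

The recurrent diffusion returns to every interior point after every rational
time; as its paths are continuous and l, r absorbing, this forces zeta = +oo
almost surely ([lifetime_infinite]).

The total mass of A is infinite.  Let v_c(x) be the probability, under
[law X x], that A stays below c.  Suppose that v_c is constant.  When A stays
below c, so does its increment after a time t, and this increment even stays
below c - e if A_t > e; by the Markov property at t,
v_c <= P^y(A_t <= e) v_c + v_(c-e).  As the Revuz measure of A is not zero,
there are y, t and e > 0 with P^y(A_t > e) > 0 ([af_charges]), and v_c = 0
follows by induction on c ([af_below_null]).

That v_c is constant would be the strong Markov property at T_y, if A were
additive at T_y.  But A is additive at deterministic times only, each with its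
own null set, and v_c is merely universally measurable.  So the strong Markov
property is applied to X alone, on a window [T_y, T_y + h[ of times.  For a
deterministic s, almost surely, if A stays below c then so does its increment
after s; integrated over the times s of the window, this gives
h v_c(z) <= E^z int_(T_y)^(T_y + h) v_c(X_s) ds
         = E^y int_0^h v_c(X_s) ds
        <= h P^y(the increment of A after h stays below c),
where for the equality v_c is replaced by Borel functions that agree almost
everywhere for the occupation measure ([umeasurable_sandwich]).  Letting h tend
to 0 gives v_c(z) <= v_c(y) ([af_below_const]).

The transformed laws.  For a time T at which X is at y, the transformation says
Q^x(T < zeta) = g(y) / g(x) E^x[exp(-A_T)] ([Q_hit]), and E^x[exp(-A_T)] tends
to 0 when T tends to +oo, since A_oo = +oo ([discount_small]).  Consequently:
- under Q^x the process finally leaves every point and every compact interval,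
  hence converges to l or to r ([Q_ends]);
- if g(b) <= g(x) for b close to r, then Q^x(X -> r) <= Q^x(T_b < zeta)
  <= E^x[exp(-A_(T_b))], which tends to 0 as b tends to r ([Q_limit_null]);
  this is (1), where g is nonincreasing, and similarly (2);
- if z > x and g(z) > g(x), let S be the first visit of x after T_z; then
  Q^x(T_z < zeta) - Q^x(S < zeta) >= (g(z) / g(x) - 1) E^x[exp(-A_(T_z))] > 0,
  and a path that visits z but never x again converges to r ([Q_limit_pos]);
- were X recurrent under Q, then g(y) E^x[exp(-A_(T_y))] = g(x) for all x and y,
  so that g would be constant and all these expectations 1, although they tend
  to 0 as y tends to r ([Q_transient]).
For (3) such a z exists, because psi is nonconstant, nondecreasing and convex as
a function of the scale ([solution_convex]), and the scale is unbounded at r by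
recurrence ([scale_unbounded_right]).  The end l is treated in the same way. *)

(** * Measure theory *)

(** The integral of a nonnegative function is a supremum over simple functions.
Monotonicity and scaling follow from this alone, which matters for integrands
such as exp(-A_T), with T a random time, and for integrands known only up to a
null set. *)
Section lower_integral.
Context d (T : measurableType d) (R : realType) (mu : {measure set T -> \bar R}).
Implicit Types (f g : T -> \bar R) (D : set T).
Import HBNNSimple.

Lemma sintegral_integral (h : {nnsfun T >-> R}) :
  sintegral mu h = \int[mu]_w (h w)%:E.
Proof. by rewrite integral_nnsfun// patch_setT. Qed.

Lemma ge0_le_integral_ae D E f g :
  (forall w, D w -> 0 <= f w) -> (forall w, E w -> 0 <= g w) ->
  {ae mu, forall w, D w -> E w /\ f w <= g w} ->
  \int[mu]_(w in D) f w <= \int[mu]_(w in E) g w.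
Proof.
move=> f0 g0 [N [mN N0 DN]].
have fg w : ~ N w -> (f \_ D) w <= (g \_ E) w.
  move=> Nw; have {}Nw : D w -> E w /\ f w <= g w.
    by apply: contrapT => h; apply: Nw; apply: DN.
  rewrite /patch; case: ifPn => [/set_mem Dw|_].
    by have [Ew ?] := Nw Dw; rewrite mem_set.
  by case: ifPn => // /set_mem/g0.
rewrite !ge0_integralE//; apply: ge_ereal_sup => _ [h /= hf <-].
have mNC : measurable (~` N) by exact: measurableC.
rewrite [leLHS](_ : _ = sintegral mu (proj_nnsfun h mNC)).
  apply: ereal_sup_ubound; exists (proj_nnsfun h mNC) => // w /=.
  have [Nw|Nw] := pselect (N w).
    rewrite /= mindicE memNset ?mulr0; last by move=> /(_ Nw).
    by apply: erestrict_ge0 => // ? /g0.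
  by rewrite mindicE mem_set// mulr1 (le_trans (hf _))// fg.
rewrite !sintegral_integral.
apply: ge0_ae_eq_integral => //; [exact/measurable_EFinP|exact/measurable_EFinP|
  by move=> x _; rewrite lee_fin| by move=> x _; rewrite lee_fin|].
exists N; split => // w /=; apply: contra_notP => Nw _.
by rewrite mindicE mem_set// mulr1.
Qed.

Lemma le_integral_lower D f g : (forall w, D w -> 0 <= f w <= g w) ->
  \int[mu]_(w in D) f w <= \int[mu]_(w in D) g w.
Proof.
move=> fg; apply: ge0_le_integral_ae => [w /fg/andP[]//|w /fg/andP[+ +]|].
  exact: le_trans.
by apply: aeW => w Dw; split => //; case/andP: (fg _ Dw).
Qed.

Lemma ge0_integralZl_lower (k : R) D f : (0 < k)%R ->
  (forall w, D w -> 0 <= f w) ->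
  \int[mu]_(w in D) (k%:E * f w) = k%:E * \int[mu]_(w in D) f w.
Proof.
suff le c h : (0 < c)%R -> (forall w, D w -> 0 <= h w) ->
    \int[mu]_(w in D) (c%:E * h w) <= c%:E * \int[mu]_(w in D) h w.
  move=> k0 f0; apply/eqP; rewrite eq_le le//=.
  have := le k^-1%R (fun w => k%:E * f w).
  rewrite invr_gt0 => /(_ k0) /(_ (fun w Dw => mule_ge0 (ltW _) (f0 w Dw))).
  under eq_integral do rewrite muleA -EFinM mulVf ?gt_eqF// mul1e.
  move=> /(_ k0) h; rewrite -lee_pdivlMl//.
move=> c0 h0; rewrite [leLHS]ge0_integralE; last first.
  by move=> w Dw; rewrite mule_ge0 ?h0// lee_fin ltW.
apply: ge_ereal_sup => _ [u /= uh <-].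
have c'0 : (0 <= c^-1)%R by rewrite invr_ge0 ltW.
rewrite -lee_pdivrMl// sintegral_integral.
rewrite -ge0_integralZl_EFin//; [|by move=> *; rewrite lee_fin|exact/measurable_EFinP].
rewrite [leRHS]integral_mkcond; apply: le_integral_lower => w _.
rewrite mule_ge0 ?lee_fin//= lee_pdivrMl// (le_trans (uh w))//.
by rewrite /patch; case: ifP => //; rewrite mule0.
Qed.

Lemma integral_eq0_ae D f : {ae mu, forall w, D w -> f w = 0} ->
  (forall w, D w -> 0 <= f w) -> \int[mu]_(w in D) f w = 0.
Proof.
move=> f0 fge0; apply/eqP; rewrite eq_le integral_ge0// andbT.
rewrite -[leRHS](integral0 mu D); apply: ge0_le_integral_ae => //.
by apply: filterS f0 => w h Dw; split=> //; rewrite h.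
Qed.

End lower_integral.

Section limsup.
Context d (T : measurableType d) (R : realType) (P : probability T R).

(** The reverse Fatou lemma for events, in the form that serves below: a lower
bound for all P (F n) passes to any event that contains the limit superior of
F almost surely. *)
Lemma le_limsup_probability (k : \bar R) (F : (set T)^nat) (D : set T) :
  (forall n, measurable (F n)) -> measurable D -> (forall n, k <= P (F n)) ->
  {ae P, forall w, (forall N, exists2 n, (N <= n)%N & F n w) -> D w} ->
  k <= P D.
Proof.
move=> mF mD kF [N [mN N0 DN]].
apply: (@le_trans _ _ (P (lim_sup_set F))).
  rewrite -(cvg_lim _ (lim_sup_set_cvg P F mF _))//; last first.
    rewrite (le_lt_trans (probability_le1 _ _)) ?ltry//.
    exact: bigcup_measurable.
  apply: lime_ge.
    apply/cvg_ex; eexists; apply: lim_sup_set_cvg => //.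
    rewrite (le_lt_trans (probability_le1 _ _)) ?ltry//.
    exact: bigcup_measurable.
  apply: nearW => n; apply: le_trans (kF n) _.
  by apply: le_measure; rewrite ?inE//; [exact: bigcup_measurable|move=> w; exists n => /=].
have mL : measurable (lim_sup_set F).
  by apply: bigcap_measurable => // k' _; exact: bigcup_measurable.
rewrite -[leRHS]adde0 -N0.
apply: le_trans (measureU2 _ _ _) => //.
apply: le_measure; rewrite ?inE//; first exact: measurableU.
move=> w Fw; have [|Dw] := pselect (D w); [by left|right].
apply: DN => /= h; apply: Dw; apply: h => n.
by have [m ? ?] := Fw n Logic.I; exists m.
Qed.

End limsup.

Lemma ae_forall_rat d (T : measurableType d) (R : realType)
    (mu : {measure set T -> \bar R}) (P : rat -> T -> Prop) :
  (forall q, {ae mu, forall w, P q w}) -> {ae mu, forall w, forall q, P q w}.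
Proof.
move=> h; have : {ae mu, forall w, forall n, forall q, unpickle n = Some q -> P q w}.
  apply: ae_foralln => n; case: (unpickle n) => [q|]; last exact: aeW.
  by apply: filterS (h q) => w Pq _ [<-].
by apply: filterS => w hw q; exact: (hw (pickle q) q (pickleK q)).
Qed.

Lemma probability1_ae d (T : measurableType d) (R : realType)
    (P : probability T R) (A : set T) : measurable A -> P A = 1 ->
  {ae P, forall w, A w}.
Proof.
move=> mA PA; exists (~` A); split => //; first exact: measurableC.
by rewrite probability_setC// PA subee.
Qed.

Section ae_measure.
Context d (T : measurableType d) (R : realType) (mu : {measure set T -> \bar R}).

Lemma le_measure_ae (A B : set T) : measurable A -> measurable B ->
  {ae mu, forall w, A w -> B w} -> mu A <= mu B.
Proof.
move=> mA mB [N [mN N0 AB]]; rewrite -[leRHS]adde0 -N0.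
apply: le_trans (measureU2 _ _ _) => //.
apply: le_measure; rewrite ?inE//; first exact: measurableU.
move=> w Aw; have [|nBw] := pselect (B w); [by left|right].
by apply: AB => /= /(_ Aw).
Qed.

Lemma eq_measure_ae (A B : set T) : measurable A -> measurable B ->
  {ae mu, forall w, A w <-> B w} -> mu A = mu B.
Proof.
move=> mA mB AB; apply/eqP; rewrite eq_le; apply/andP; split;
  by apply: le_measure_ae => //; apply: filterS AB => w [].
Qed.

End ae_measure.

(** [filterS] for almost sure statements on the sample space, which carries two
sigma-algebras: unification is not left to choose between them. *)
Lemma ae_imp d (T : measurableType d) (R : realType) (mu : {measure set T -> \bar R})
    (P P' : T -> Prop) : (forall w, P w -> P' w) ->
  {ae mu, forall w, P w} -> {ae mu, forall w, P' w}.
Proof. by move=> PP' [N [mN N0 PN]]; exists N; split => // w /= nP; apply: PN => /PP'. Qed.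

Lemma ae_imp2 d (T : measurableType d) (R : realType) (mu : {measure set T -> \bar R})
    (P1 P2 P' : T -> Prop) : (forall w, P1 w -> P2 w -> P' w) ->
  {ae mu, forall w, P1 w} -> {ae mu, forall w, P2 w} -> {ae mu, forall w, P' w}.
Proof. by move=> PP'; exact: filterS2. Qed.

Lemma measurable_patch d (T : measurableType d) (R : realType) (S : set T)
    (f : T -> \bar R) :
  measurable S -> measurable_fun setT f -> measurable_fun setT (fun p => (f \_ S) p).
Proof. by move=> mS mf; exact: ((measurable_restrictT f mS).1 (measurable_funTS mf)). Qed.

Section image_measure.
Context d1 d2 (T1 : measurableType d1) (T2 : measurableType d2) (R : realType).

(** Applied to path evaluation on a window of times, this yields the occupation
measure of the state space. *)
Lemma restricted_image_measure (m : {measure set T1 -> \bar R}) (S : set T1)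
    (f : T1 -> T2) :
  measurable S -> m S < +oo -> measurable_fun setT f ->
  exists nu : {finite_measure set T2 -> \bar R},
    forall B, measurable B -> nu B = m (f @^-1` B `&` S).
Proof.
move=> mS mSoo mf.
pose nu0 : set T2 -> \bar R := pushforward (mrestr m mS) f.
have nu0_0 : nu0 set0 = 0 by rewrite /nu0 /pushforward preimage_set0 measure0.
have nu0_ge0 A : 0 <= nu0 A by exact: measure_ge0.
have nu0_sigma : semi_sigma_additive nu0.
  move=> F mF tF mUF; rewrite /nu0 /pushforward preimage_bigcup.
  apply: measure_semi_sigma_additive.
  - by move=> n; rewrite -[X in measurable X]setTI; exact: mf.
  - apply/trivIsetP => /= i j _ _ ij; rewrite -preimage_setI.
    by move/trivIsetP : tF => /(_ _ _ _ _ ij) ->//; rewrite preimage_set0.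
  - by rewrite -preimage_bigcup -[X in measurable X]setTI; exact: mf.
have nu0_fin : fin_num_fun nu0.
  move=> B mB; rewrite ge0_fin_numE//; apply: le_lt_trans mSoo.
  rewrite /nu0 /pushforward /mrestr; apply: le_measure; rewrite ?inE//.
  by apply: measurableI => //; rewrite -[X in measurable X]setTI; exact: mf.
pose H0 := isMeasure.Build _ _ _ nu0 nu0_0 nu0_ge0 nu0_sigma.
pose nu1 : {measure set T2 -> \bar R} := HB.pack nu0 H0.
pose H1 := Measure_isFinite.Build _ _ _ (Measure.sort nu1) nu0_fin.
pose nu2 : {finite_measure set T2 -> \bar R} := HB.pack (Measure.sort nu1) H1.
by exists nu2.
Qed.

End image_measure.

Lemma lebesgue_translation (R : realType) (a : R) (f : R -> \bar R) :
  measurable_fun [set: measurableTypeR R] f -> (forall t, 0 <= f t) ->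
  \int[@lebesgue_measure R]_t f (t + a)%R = \int[@lebesgue_measure R]_t f t.
Proof.
move=> mf f0; pose tr : measurableTypeR R -> measurableTypeR R := fun t => (t + a)%R.
have mtr : measurable_fun setT tr by apply: measurable_funD.
transitivity (\int[pushforward (@lebesgue_measure R) tr]_t f t).
  by rewrite ge0_integral_pushforward.
apply: eq_measure_integral => A mA _; apply/esym/lebesgue_measure_unique => //.
move=> _ [[u v]] _ <-.
have E : tr @^-1` `]u, v]%classic = `](u - a)%R, (v - a)%R]%classic.
  by apply/seteqP; split=> t /=; rewrite !in_itv/= /tr ltrBlDr lerBrDr.
rewrite -[RHS]/(lebesgue_measure (tr @^-1` `]u, v]%classic)) E.
rewrite !lebesgue_measure_itv/= !lte_fin ltrD2r -!EFinD.
by case: ifP => // _; congr (_%:E); lra.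
Qed.

Section sandwich.
Context (R : realType).
Implicit Types (nu : {finite_measure set (\bar R) -> \bar R}).

Let level (n : nat) : R := `|ratr (odflt (0 : rat) (unpickle n))|%R.

Let step (F : (set (\bar R))^nat) (x : \bar R) : \bar R :=
  esups (fun n => (level n * \1_(F n) x)%:E) 0%N.

Let step_measurable F : (forall n, measurable (F n)) -> measurable_fun setT (step F).
Proof.
move=> mF; apply: measurable_fun_esups => n; apply/measurable_EFinP.
by apply: measurable_funM.
Qed.

Let step_ub F n x : (level n * \1_(F n) x)%:E <= step F x.
Proof. by apply: ereal_sup_ubound; exists n. Qed.

Let step_le F x c : (forall n, (level n * \1_(F n) x)%:E <= c) -> step F x <= c.
Proof. by move=> h; apply: ge_ereal_sup => _ [n _ <-]. Qed.

(** The function v is the supremum of q times the indicator of v > q, over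
nonnegative rationals q; replacing each of these sets by a Borel set inside or
outside it, of the same measure, gives v1 and v2. *)
Lemma umeasurable_sandwich nu (D : set (\bar R)) (v : \bar R -> \bar R) :
  umeasurable_fun D v -> (forall x, D x -> 0 <= v x) ->
  exists v1 v2 : \bar R -> \bar R,
    [/\ measurable_fun setT v1, measurable_fun setT v2,
        forall x, 0 <= v1 x /\ 0 <= v2 x,
        forall x, D x -> v1 x <= v x <= v2 x &
        exists2 N, measurable N /\ nu N = 0 & forall x, ~ N x -> v1 x = v2 x].
Proof.
move=> um v0.
have /choice[CD CDP] : forall n, exists CD : set (\bar R) * set (\bar R),
    [/\ measurable CD.1, measurable CD.2,
        CD.1 `<=` D `&` v @^-1` `](level n)%:E, +oo],
        D `&` v @^-1` `](level n)%:E, +oo] `<=` CD.2 & nu (CD.2 `\` CD.1) = 0].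
  move=> n; have [C [E h]] := um _ (emeasurable_itv `](level n)%:E, +oo]) nu.
  by exists (C, E).
have st0 F x : 0 <= step F x.
  apply: le_trans (step_ub F 0%N x); rewrite lee_fin mulr_ge0//.
  by rewrite /level.
exists (step (fun n => (CD n).1)), (step (fun n => (CD n).2)); split=> //.
- by apply: step_measurable => n; case: (CDP n).
- by apply: step_measurable => n; case: (CDP n).
- move=> x Dx; apply/andP; split.
    apply: step_le => n; rewrite indicE; case: (boolP (x \in _)) => [/set_mem xC|_].
      case: (CDP n) => _ _ /(_ x xC)[_ /=]; rewrite in_itv/= leey andbT => lv _ _.
      by rewrite mulr1 ltW.
    by rewrite mulr0 v0.
  rewrite leNgt; apply/negP => sv.
  have [q q0 /andP[sq qv]] : exists2 q : rat, (0 <= q)%R &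
      step (fun n => (CD n).2) x < (ratr q)%:E < v x.
    move: sv (st0 (fun n => (CD n).2) x); case: (step _ x) => [s||]//; case: (v x) => [y||]//.
    - rewrite lte_fin lee_fin => sy s0; have [q] := rat_in_itvoo sy.
      rewrite in_itv/= => /andP[sq qy]; exists q; last by rewrite !lte_fin sq.
      by rewrite -(ler0q R) (le_trans s0)// ltW.
    - move=> _ _; exists (Num.truncn s).+1%:R => //.
      by rewrite ltry andbT lte_fin ratr_nat truncnS_gt.
  have lq : level (pickle q) = ratr q.
    by rewrite /level pickleK/= ger0_norm// ler0q.
  have := step_ub (fun n => (CD n).2) (pickle q) x; rewrite lq indicE mem_set.
    by rewrite mulr1 leNgt sq.
  case: (CDP (pickle q)) => _ _ _ h _; apply: h; split => //=.
  by rewrite in_itv/= lq qv leey.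
- exists (\bigcup_n ((CD n).2 `\` (CD n).1)).
    have mN n : measurable ((CD n).2 `\` (CD n).1).
      by case: (CDP n) => ? ? _ _ _; exact: measurableD.
    split; first exact: bigcupT_measurable.
    apply: measure_negligible; first exact: bigcupT_measurable.
    apply: negligible_bigcup => n; exists ((CD n).2 `\` (CD n).1); split => //.
    by case: (CDP n).
  move=> x nN; rewrite /step; congr (esups _ _); apply/funext => n.
  congr ((_ * _)%:E); rewrite !indicE; congr (_%:R); congr nat_of_bool.
  apply/idP/idP => /set_mem h; apply/mem_set.
    by case: (CDP n) => _ _ h1 h2 _; apply/h2/h1.
  by apply: contrapT => nC; apply: nN; exists n.
Qed.

End sandwich.

(** * Continuous paths with absorbing ends *)

Section paths.
Context {R : realType} (l r : \bar R).
Implicit Types (p : R -> \bar R) (s : \bar R) (D : set (\bar R)).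

Notation I := (`]l, r[%classic : set (\bar R)).

Definition next_time (s : \bar R) D p : \bar R :=
  ereal_inf [set t%:E | t in [set t : R | s < t%:E /\ D (p t)]].

Definition absorbed_path p :=
  [/\ forall t, (0 <= t)%R -> l <= p t <= r,
      {within `[0%R, +oo[, continuous p} &
      forall s t : R, (0 <= s <= t)%R -> [set l; r] (p s) -> p t = p s].

Lemma next_time_lt s D p (t : \bar R) :
  next_time s D p < t <-> exists u : R, [/\ s < u%:E, u%:E < t & D (p u)].
Proof.
split=> [/ereal_inf_lt[_ [u [su Dpu] <-] ut]|[u [su ut Dpu]]]; first by exists u.
by apply: le_lt_trans ut; apply: ereal_inf_lbound; exists u.
Qed.

Lemma le_next_time s D p : s <= next_time s D p.
Proof. by apply/le_ereal_inf_tmp => _ [t [st _] <-]; exact: ltW. Qed.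

(** The form in which the range of the paths is known: between l and r. *)
Lemma interior_not_end x : I x <-> l <= x <= r /\ ~ [set l; r] x.
Proof.
rewrite /= in_itv /=; split=> [/andP[lx xr]|[/andP[lx xr] nx]].
  by rewrite !ltW//; split=> // -[] xE; move: lx xr; rewrite xE ltxx.
rewrite !lt_neqAle lx xr !andbT; apply/andP; split; apply/eqP => xE.
  by apply: nx; left.
by apply: nx; right.
Qed.

Lemma interior_fin x : I x -> (fine x)%:E = x.
Proof.
rewrite /= in_itv/= => /andP[lx xr]; rewrite fineK// fin_numElt.
by rewrite (le_lt_trans (leNye _) lx) (lt_le_trans xr (leey _)).
Qed.

Section one_path.
Variable p : R -> \bar R.
Hypothesis pP : absorbed_path p.

(* continuous on all of R, so that the topology of R applies directly *)
Let pext (t : R) : \bar R := p (Num.max 0 t)%R.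

Let pextE (t : R) : (0 <= t)%R -> pext t = p t.
Proof. by move=> t0; rewrite /pext max_r. Qed.

Lemma path_cvg (t : R) : (0 <= t)%R ->
  p u @[u --> within `[0%R, +oo[ (nbhs t)] --> p t.
Proof.
case: pP => _ /subspace_continuousP cp _ t0; apply: cp.
by rewrite /= in_itv/= t0.
Qed.

Let pext_continuous : continuous pext.
Proof.
move=> t0; pose t : R := t0; have m0 : (0 <= Num.max 0 t)%R by rewrite le_max lexx.
pose m (u : R) : R := Num.max 0%R u.
have cm : (m @ (t : R)) --> m t.
  by apply: (@continuous_max _ _ (cst 0%R) id); [exact: cvg_cst|exact: cvg_id].
have h : (m @ (t : R)) --> within `[0%R, +oo[ (nbhs (m t)).
  move=> A nA; have := cm _ nA; apply: (@filterS _ (nbhs (t:R))) => u /=; apply.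
  by rewrite in_itv/= andbT le_max lexx.
exact: (cvg_trans (cvg_app p h) (path_cvg m0)).
Qed.

Lemma next_time_in D s (t : R) : closed D -> 0 <= s -> next_time s D p = t%:E ->
  (0 <= t)%R /\ D (p t).
Proof.
move=> cD s0 tE.
have t0 : (0 <= t)%R by rewrite -lee_fin -tE; exact: le_trans (le_next_time _ _ _).
split => //; apply: contrapT => nD.
have : nbhs t [set u | ~ D (pext u)].
  apply: (@pext_continuous t (~` D)).
  by apply: open_nbhs_nbhs; split; [exact: closed_openC|rewrite pextE].
move=> /nbhs_ballP[e /= e0 he].
have : next_time s D p < (t + e)%:E by rewrite tE lte_fin ltrDl.
move=> /next_time_lt[u [su ut Du]].
have tu : (t <= u)%R.
  by rewrite -lee_fin -tE; apply: ereal_inf_lbound; exists u.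
have /he : ball t e u.
  rewrite /ball/= ler0_norm ?subr_le0// opprB ltrBlDl.
  by rewrite lte_fin in ut.
by rewrite /= pextE ?(le_trans t0).
Qed.

Notation zeta := (next_time 0 [set l; r] p).

Lemma closed_ends : closed [set l; r].
Proof. by apply: closedU; apply: accessible_closed_set1; apply: hausdorff_accessible;
  exact: ereal_hausdorff. Qed.

(** Absorption makes the position at time t tell whether the lifetime has been
reached, so that events about the lifetime become events about X t. *)
Lemma live_interior (t : R) : (0 <= t)%R -> (t%:E < zeta <-> I (p t)).
Proof.
case: (pP) => rg _ ab t0; rewrite interior_not_end; split.
- move=> tz; split; first exact: rg.
  move: t0; rewrite le_eqVlt => /predU1P[t0|t0 E].
    subst t => E; have [u u0 uz] : exists2 u : R, (0 < u)%R & u%:E < zeta.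
      move: tz; case: (next_time _ _ _) => [z z0|_|//].
        by exists (z / 2)%R; rewrite ?lte_fin in z0 *; lra.
      by exists 1%R; rewrite ?ltry.
    move: uz; rewrite ltNge => /negP; apply; apply: ereal_inf_lbound.
    by exists u => //=; split => //; rewrite (ab 0%R) ?lexx ?ltW.
  by move: tz; rewrite ltNge => /negP; apply; apply: ereal_inf_lbound; exists t.
- move=> [_ nE]; rewrite ltNge; apply/negP => zt.
  have z0 := le_next_time 0 [set l; r] p.
  have [z zE] : exists z : R, zeta = z%:E.
    exists (fine zeta); rewrite fineK// ge0_fin_numE//.
    by rewrite (le_lt_trans zt)// ltry.
  have [z0' Ez] := next_time_in closed_ends (lexx 0) zE.
  by apply: nE; rewrite (ab z) // z0' /= -lee_fin -zE.
Qed.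

(** The intermediate value theorem for extended real paths, through the
connectedness of [a, b]. *)
Lemma path_avoid (a b : R) c : (0 <= a)%R -> (a <= b)%R ->
  (forall u, (a <= u <= b)%R -> p u <> c) ->
  (forall u, (a <= u <= b)%R -> p u < c) \/
  (forall u, (a <= u <= b)%R -> c < p u).
Proof.
move=> a0 ab nc; have ge0 u : (a <= u <= b)%R -> (0 <= u)%R.
  by case/andP => + _; exact: le_trans.
have [[u0 u0ab u0c]|none] := pselect (exists2 u, (a <= u <= b)%R & p u < c).
  left; pose B := [set u : R | (a <= u <= b)%R /\ pext u < c].
  suff BE : B = `[a, b]%classic.
    move=> u uab; have : `[a, b]%classic u by rewrite /= in_itv.
    by rewrite -BE => -[_]; rewrite pextE// ge0.
  apply: (@segment_connected _ a b).
  - by exists u0; split => //; rewrite pextE ?ge0.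
  - exists (pext @^-1` [set y | y < c]).
      by apply: open_comp => [x _|]; [exact: pext_continuous|exact: open_ereal_lt_ereal].
    by apply/seteqP; split=> u /=; rewrite in_itv/=.
  - exists (pext @^-1` [set y | y <= c]).
      apply: closed_comp => [x _|]; first exact: pext_continuous.
      exact: closed_ereal_ge_ereal.
    apply/seteqP; split=> u /=; rewrite in_itv/=; first by case=> ? /ltW.
    move=> [uab uc]; split => //; rewrite lt_neqAle uc andbT.
    by apply/eqP; rewrite pextE ?ge0//; exact: nc.
right => u uab; rewrite ltNge le_eqVlt; apply/negP => /orP[/eqP|pu].
  exact: nc.
by apply: none; exists u.
Qed.

(** The image of [a, b] is compact, so its complement is a neighbourhood of each
of its points. *)
Lemma path_avoid_nbhs (a b : R) c : (0 <= a)%R ->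
  (forall u, (a <= u <= b)%R -> p u <> c) ->
  \forall y \near c, forall u, (a <= u <= b)%R -> p u <> y.
Proof.
move=> a0 nc; have cK : closed (pext @` `[a, b]).
  apply: compact_closed; first exact: ereal_hausdorff.
  apply: continuous_compact; last exact: segment_compact.
  exact: continuous_subspaceT.
have : nbhs c (~` (pext @` `[a, b])).
  apply: open_nbhs_nbhs; split; first exact: closed_openC.
  move=> -[u /=]; rewrite in_itv/= => uab; rewrite pextE; first exact: nc.
  by case/andP: uab => + _; exact: le_trans.
apply: filterS => y ny u uab puy; apply: ny; exists u; first by rewrite /= in_itv.
by rewrite pextE//; case/andP: uab => + _; exact: le_trans.
Qed.

(** By compactness, a level is visited during [a, b] when it is approached
arbitrarily well at rational times: visits are events of the sigma-algebra
generated by countably many positions. *)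
Lemma path_hits_rat (a b : rat) (y : R) : (0 <= a)%R -> (a < b)%R ->
  (exists2 u : R, (ratr a <= u <= ratr b)%R & p u = y%:E) <->
  forall n : nat, exists2 q : rat, (a <= q <= b)%R &
    (y - n.+1%:R^-1)%:E < p (ratr q) < (y + n.+1%:R^-1)%:E.
Proof.
move=> a0 ab; have ra0 : (0 <= ratr a :> R)%R by rewrite ler0q.
split=> [[u uab puy] n|h].
- have n0 : (0 < n.+1%:R^-1 :> R)%R by rewrite invr_gt0.
  have u0 : (0 <= u)%R by case/andP: uab => + _; exact: le_trans.
  have : nbhs (pext u) [set z | (y - n.+1%:R^-1)%:E < z < (y + n.+1%:R^-1)%:E].
    rewrite pextE// puy; apply: open_nbhs_nbhs; split; last first.
      by rewrite /= !lte_fin ltrBlDr ltrDl n0.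
    rewrite [X in open X](_ : _ = [set z | (y - n.+1%:R^-1)%:E < z] `&`
      [set z | z < (y + n.+1%:R^-1)%:E]); last first.
      by apply/seteqP; split=> z /= => [/andP[]|[-> ->]].
    by apply: openI; [exact: open_ereal_gt_ereal|exact: open_ereal_lt_ereal].
  move=> /(@pext_continuous u) /nbhs_ballP[e /= e0 he].
  have rab : (ratr a < ratr b :> R)%R by rewrite ltr_rat.
  have : (Num.max (ratr a) (u - e) < Num.min (ratr b) (u + e))%R.
    by rewrite lt_min !gt_max rab/=; lra.
  move=> /rat_in_itvoo[q]; rewrite in_itv/= gt_max lt_min.
  move=> /andP[/andP[aq uq] /andP[qb qu]]; exists q.
    by rewrite -(ler_rat R) -(ler_rat R _ b) !ltW.
  have /he : ball u e (ratr q).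
    by rewrite /ball/= ltr_norml; apply/andP; split; lra.
  by rewrite /= pextE// (le_trans ra0)// ltW.
- apply: contrapT => nh.
  have : forall u, (ratr a <= u <= ratr b)%R -> p u <> y%:E.
    by move=> u uab puy; apply: nh; exists u.
  move=> /(path_avoid_nbhs ra0); rewrite nbhs_EFin => /nbhs_ballP[e /= e0 he].
  have [n ne] : exists n : nat, (n.+1%:R^-1 < e)%R.
    exists (Num.truncn e^-1); rewrite invf_plt ?posrE//.
    exact: truncnS_gt.
  have [q qab /andP[yq qy]] := h n.
  have /fineK pq : p (ratr q) \is a fin_num.
    by rewrite fin_numElt (lt_trans (ltNyr _) yq) (lt_trans qy (ltry _)).
  have := he (fine (p (ratr q))); rewrite pq.
  apply; last by [].
    rewrite -pq !lte_fin in yq qy.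
    move: ne yq qy; set d := (_^-1)%R => ne yq qy.
    by rewrite /ball/= ltr_norml; apply/andP; split; lra.
  by rewrite !ler_rat.
Qed.

End one_path.
End paths.

Section ends.
Context {R : realType} (l r : \bar R).
Implicit Types (D : set (\bar R)).
Notation I := (`]l, r[%classic : set (\bar R)).

(** A countable basis, within [l, r], of the neighbourhoods of e: convergence to
e becomes countably many conditions on the path. *)
Definition end_basis (e : \bar R) (B : (set (\bar R))^nat) :=
  [/\ forall n, closed (B n), forall n, measurable (B n),
      forall n, nbhs e (B n) &
      forall A, nbhs e A -> exists n, forall y, l <= y <= r -> B n y -> A y].

Lemma left_end_seq (x : \bar R) : l < x ->
  exists2 a : (\bar R)^nat, (forall n, l < a n < x) & a @ \oo --> l.
Proof.
move=> lx; have [y ly yx] : exists2 y : R, l < y%:E & y%:E < x.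
  case: x l lx => [x||] [l'||]//= lx.
  - by exists ((l' + x) / 2)%R; rewrite ?lte_fin in lx *; lra.
  - by exists (x - 1)%R; rewrite ?ltNyr// lte_fin; lra.
  - by exists (l' + 1)%R; rewrite ?ltry// lte_fin; lra.
  - by exists 0%R; rewrite ?ltNyr ?ltry.
case: l lx ly => [l'||]//= lx ly.
- exists (fun n => (l' + (y - l') * harmonic n)%:E).
    move=> n; rewrite lte_fin in ly; apply/andP; split.
      by rewrite lte_fin ltrDl mulr_gt0// ?subr_gt0// invr_gt0.
    apply: le_lt_trans yx; rewrite lee_fin -lerBrDl ler_piMr//.
      by rewrite subr_ge0 ltW.
    by rewrite /harmonic/= invf_le1// ler1n.
  apply: cvg_EFin; first exact: nearW.
  rewrite -[X in _ --> X]addr0; apply: cvgD; first exact: cvg_cst.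
  rewrite -[X in _ --> X](mulr0 (y - l')%R); apply: cvgM; first exact: cvg_cst.
  exact: cvg_harmonic.
- exists (fun n => (y - n.+1%:R)%:E).
    move=> n; rewrite ltNyr/=; apply: lt_trans yx.
    by rewrite lte_fin ltrBlDr ltrDl.
  apply/cvgeNyPle => A; exists (Num.truncn (y - A)) => // n /= yAn.
  rewrite lee_fin lerBlDr -lerBlDl ltW//.
  by apply: lt_le_trans (truncnS_gt _) _; rewrite ler_nat.
Qed.

End ends.

Lemma right_end_seq (R : realType) (r x : \bar R) : x < r ->
  exists2 a : (\bar R)^nat, (forall n, x < a n < r) & a @ \oo --> r.
Proof.
rewrite -lteN2 => /left_end_seq[a ar aN]; exists (fun n => - a n) => [n|].
  by have /andP[h1 h2] := ar n; rewrite lteNr h2 lteNl.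
by rewrite -[X in _ --> X]oppeK; exact: cvgeN.
Qed.

Section ends.
Context {R : realType} (l r : \bar R).
Notation I := (`]l, r[%classic : set (\bar R)).

Lemma left_end_basis (a : (\bar R)^nat) :
  (forall n, l < a n) -> a @ \oo --> l ->
  end_basis l r l (fun n => [set y | y <= a n]).
Proof.
move=> la al; split=> [n|n|n|A nA].
- exact: closed_ereal_ge_ereal.
- have -> : [set y | y <= a n] = `]-oo, a n]%classic.
    by apply/seteqP; split=> y /=; rewrite in_itv.
  exact: emeasurable_itv.
- by apply: filterS (open_ereal_lt' (la n)) => y /ltW.
- have [c lc cA] : exists2 c, l < c & forall y, l <= y < c -> A y.
    have lfin := la 0%N; case: l nA lfin {la al} => [l'||] nA lfin.
    + move: nA => /(nbhs_EFin A _)/nbhs_ballP[e /= e0 he].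
      exists (l' + e)%:E; first by rewrite lte_fin ltrDl.
      case=> [y||]; rewrite ?ltNge ?leey ?andbF// -ltNge lee_fin lte_fin => /andP[ly ye].
      by apply: he; rewrite /ball/= ltr_norml; apply/andP; split; lra.
    + by move: lfin; rewrite ltNge leey.
    + case: nA => M [_ hM]; exists M%:E; first exact: ltNyr.
      by move=> y /andP[_]; exact: hM.
  have [n _ /(_ n (leqnn n)) /= h] := al _ (open_ereal_lt' lc).
  exists n => y /andP[ly _] ya; apply: cA; rewrite ly/=.
  exact: le_lt_trans h.
Qed.

Lemma right_end_basis (b : (\bar R)^nat) :
  (forall n, b n < r) -> b @ \oo --> r ->
  end_basis l r r (fun n => [set y | b n <= y]).
Proof.
move=> br cb; split=> [n|n|n|A nA].
- exact: closed_ereal_le_ereal.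
- have -> : [set y | b n <= y] = `[b n, +oo[%classic.
    by apply/seteqP; split=> y /=; rewrite in_itv/= andbT.
  exact: emeasurable_itv.
- by apply: filterS (open_ereal_gt' (br n)) => y /ltW.
- have [c cr cA] : exists2 c, c < r & forall y, c < y <= r -> A y.
    have lfin := br 0%N; case: r nA lfin {br cb} => [r'||] nA lfin.
    + move: nA => /(nbhs_EFin A _)/nbhs_ballP[e /= e0 he].
      exists (r' - e)%:E; first by rewrite lte_fin; lra.
      case=> [y||]; rewrite ?leeNy_eq// ?lee_fin ?lte_fin => /andP[ly ye]//.
      by apply: he; rewrite /ball/= ltr_norml; apply/andP; split; lra.
    + case: nA => M [_ hM]; exists M%:E; first exact: ltry.
      by move=> y /andP[+ _]; exact: hM.
    + by move: lfin; rewrite ltNge leNye.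
  have [n _ /(_ n (leqnn n)) /= h] := cb _ (open_ereal_gt' cr).
  exists n => y /andP[_ yr] yb; apply: cA; rewrite yr andbT.
  exact: lt_le_trans h _.
Qed.

End ends.

Section ends_of_paths.
Context {R : realType} (l r : \bar R).
Notation I := (`]l, r[%classic : set (\bar R)).
Variable p : R -> \bar R.
Hypothesis pP : absorbed_path l r p.
Notation zeta := (next_time 0 [set l; r] p).

Lemma hit_lt_lifetime s y : 0 <= s -> I y ->
  next_time s [set y] p < +oo <-> next_time s [set y] p < zeta.
Proof.
move=> s0 Iy; split => [/next_time_lt[u [su _ puy]]|]; last first.
  by move=> /lt_le_trans; apply; exact: leey.
have u0 : (0 <= u)%R by rewrite -lee_fin (le_trans s0)// ltW.
apply: (@le_lt_trans _ _ u%:E); first by apply: ereal_inf_lbound; exists u.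
by apply/(live_interior pP) => //; rewrite puy.
Qed.

Lemma path_at_hit s y : 0 <= s -> next_time s [set y] p < +oo ->
  p (fine (next_time s [set y] p)) = y.
Proof.
move=> s0 soo; have t0 : 0 <= next_time s [set y] p.
  exact: le_trans (le_next_time _ _ _).
have /fineK tE : next_time s [set y] p \is a fin_num by rewrite ge0_fin_numE.
apply: (next_time_in pP _ s0 (esym tE)).2.
by apply: accessible_closed_set1; apply: hausdorff_accessible; exact: ereal_hausdorff.
Qed.

Lemma lifetime_gt0 : I (p 0%R) -> 0 < zeta.
Proof. by move/(live_interior pP (lexx 0%R)). Qed.

Lemma lifetime_yP : zeta = +oo <-> forall t, (0 <= t)%R -> I (p t).
Proof.
split=> [zE t t0|h]; first by apply/(live_interior pP t0); rewrite zE ltry.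
have := le_next_time 0 [set l; r] p; case zE: zeta => [z||]// _.
have [z0 Ez] := next_time_in pP (@closed_ends _ l r) (lexx 0) zE.
by have /(interior_not_end l r)[] := h z z0.
Qed.

(** If the lifetime z is finite, the path is constant from z on, and both limits
are its value at z; if it is infinite, the two statements are the same. *)
Lemma exits_atP (e : \bar R) : I (p 0%R) ->
  (p (fine u) @[u --> before zeta] --> e) <-> (p t @[t --> +oo%R] --> e).
Proof.
move=> /lifetime_gt0; case zE: zeta => [z||]; rewrite ?lte_fin// => z0.
- have before_proper : ProperFilter (before z%:E).
    apply: Build_ProperFilter => /(nbhs_EFin (fun u => `[0, z%:E[%classic u -> False)).
    move=> /nbhs_ballP[e0 /= e0_gt0 he].
    have m0 : (0 <= Num.max 0 (z - e0 / 2))%R by rewrite le_max lexx.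
    have mz : (Num.max 0 (z - e0 / 2) < z)%R by rewrite gt_max z0/=; lra.
    have zm : (z - e0 / 2 <= Num.max 0 (z - e0 / 2))%R by rewrite le_max lexx orbT.
    apply: (he (Num.max 0 (z - e0 / 2))%R).
      move: m0 mz zm; set m := (X in (0 <= X)%R) => m0 mz zm.
      by rewrite /ball/= ltr_norml; apply/andP; split; lra.
    by rewrite /= in_itv/= lee_fin lte_fin m0.
  have pz : p (fine u) @[u --> before z%:E] --> p z.
    move=> A /(path_cvg pP (ltW z0)) nA.
    have {}nA : \forall u \near z, (0 <= u)%R -> A (p u).
      move: (nA : \forall u \near z, `[0%R, +oo[%classic u -> A (p u)).
      by apply: filterS => u /= h u0; apply: h; rewrite in_itv/= u0.
    apply/(nbhs_EFin (fun u => `[0, z%:E[%classic u -> A (p (fine u)))).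
    by move: nA; apply: filterS => u /= h; rewrite in_itv/= lee_fin => /andP[/h].
  have [_ Ez] := next_time_in pP (@closed_ends _ l r) (lexx 0) zE.
  have tz : p t @[t --> +oo%R] --> p z.
    apply: (cvg_near_cst (p z)); exists z; split; first exact: num_real.
    move=> t zt; case: pP => _ _; apply => //.
    by rewrite (ltW z0) ltW.
  split=> h.
    by rewrite (cvg_unique (@ereal_hausdorff R) h pz).
  by rewrite (cvg_unique (@ereal_hausdorff R) h tz).
- split=> h A /h.
  + move=> [M [_ hM]]; exists (Num.max 0 M)%R; split; first exact: num_real.
    move=> t; rewrite gt_max => /andP[t0 Mt].
    by apply: (hM t%:E) => //; rewrite /= in_itv/= lee_fin ltW//= ltry.
  + move=> [M [_ hM]]; exists M; split; first exact: num_real.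
    move=> [t||]; rewrite ?lte_fin//= => Mt; last by rewrite in_itv/= ltxx andbF.
    by move=> _; exact: hM.
Qed.

Lemma path_end_cvgW (e : \bar R) (B : (set (\bar R))^nat) : end_basis l r e B ->
  (forall n, exists k : nat, forall t : R, (k%:R <= t)%R -> B n (p t)) ->
  p t @[t --> +oo%R] --> e.
Proof.
move=> [_ _ _ Bb] h A /Bb[n hn]; have [k hk] := h n.
exists k%:R; split; first exact: num_real.
move=> t /ltW kt; apply: hn; last exact: hk.
by case: pP => + _ _; apply; exact: le_trans kt.
Qed.

(** Rational times suffice, because the sets B n are closed and paths are
continuous. *)
Lemma path_end_cvgP (e : \bar R) (B : (set (\bar R))^nat) : end_basis l r e B ->
  p t @[t --> +oo%R] --> e <->
  forall n, exists k : nat, forall q : rat, (k%:R <= q)%R -> B n (p (ratr q)).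
Proof.
move=> BP; split => [pe n|h].
  have [M [_ hM]] : \forall t \near +oo%R, B n (p t).
    by apply: pe; case: BP.
  exists (Num.truncn M).+1 => q kq; apply: hM.
  by apply: lt_le_trans (truncnS_gt _) _; rewrite -(ler_rat R) ratr_nat in kq.
apply: (path_end_cvgW BP) => n; have [k hk] := h n.
exists k.+1 => t kt; have t0 : (0 < t)%R by apply: lt_le_trans kt.
apply: contrapT => nB.
have : nbhs (p t) (~` B n).
  by apply: open_nbhs_nbhs; split => //; apply: closed_openC; case: BP.
move=> /(path_cvg pP (ltW t0)) /nbhs_ballP[e0 /= e0_gt0 he].
have : (Num.max k%:R (t - e0) < t)%R.
  rewrite gt_max; apply/andP; split; last by lra.
  by apply: lt_le_trans kt; rewrite ltr_nat.
move=> /rat_in_itvoo[q]; rewrite in_itv/= gt_max => /andP[/andP[kq tq] qt].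
have /he : ball t e0 (ratr q).
  by rewrite /ball/= ltr_norml; apply/andP; split; lra.
have kq' : (k%:R <= q)%R by rewrite -(ler_rat R) ratr_nat ltW.
by apply; [rewrite /= in_itv/= andbT (le_trans _ (ltW kq))|exact: hk].
Qed.

(** A level which is no longer visited stays finally on one side of the path.
If not all levels a n are finally above the path and not all levels b n are
finally below it, the path is finally caught in an interval [a n, b m]. *)
Lemma path_dichotomy (a b : (\bar R)^nat) :
  (forall n, I (a n)) -> (forall n, I (b n)) -> a @ \oo --> l -> b @ \oo --> r ->
  (forall n, exists k : nat, forall t, (k%:R < t)%R -> p t <> a n) ->
  (forall n, exists k : nat, forall t, (k%:R < t)%R -> p t <> b n) ->
  (forall n m k, exists j, (k <= j)%N /\ ~ (a n <= p j%:R <= b m)) ->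
  p t @[t --> +oo%R] --> l \/ p t @[t --> +oo%R] --> r.
Proof.
move=> Ia Ib al br na nb nab.
have tail c : (exists k : nat, forall t, (k%:R < t)%R -> p t <> c) ->
    exists k : nat, (forall t, (k%:R <= t)%R -> p t < c) \/
      (forall t, (k%:R <= t)%R -> c < p t).
  move=> [k hk]; exists k.+1.
  have k0 : (0 <= k.+1%:R :> R)%R by [].
  have hc t : (k.+1%:R <= t)%R -> p t <> c.
    by move=> kt; apply: hk; apply: lt_le_trans kt; rewrite ltr_nat.
  have [pk|] := boolP (p k.+1%:R < c).
    left => t kt.
    case: (@path_avoid _ _ _ _ pP k.+1%:R t c k0 kt) => [u /andP[+ _]|h|h].
    - exact: hc.
    - by apply: h; rewrite kt lexx.
    - by have := h k.+1%:R; rewrite kt lexx => /(_ isT); rewrite ltNge ltW.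
  rewrite -leNgt => cp; right => t kt.
  case: (@path_avoid _ _ _ _ pP k.+1%:R t c k0 kt) => [u /andP[+ _]|h|h].
  - exact: hc.
  - by have := h k.+1%:R; rewrite kt lexx => /(_ isT); rewrite ltNge cp.
  - by apply: h; rewrite kt lexx.
have [la|] := pselect (forall n, exists k : nat, forall t, (k%:R <= t)%R -> p t < a n).
  left; apply: (path_end_cvgW (left_end_basis _ _ al)) => n.
    by have := Ia n; rewrite /= in_itv/= => /andP[].
  by have [k hk] := la n; exists k => t /hk/ltW.
move=> /existsNP[n nan]; have [k [hk|hk]] := tail _ (na n).
  by exfalso; apply: nan; exists k.
have [lb|] := pselect (forall n, exists k : nat, forall t, (k%:R <= t)%R -> b n < p t).
  right; apply: (path_end_cvgW (right_end_basis _ _ br)) => m.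
    by have := Ib m; rewrite /= in_itv/= => /andP[].
  by have [j hj] := lb m; exists j => t /hj/ltW.
move=> /existsNP[m nbm]; have [j [hj|hj]] := tail _ (nb m); last first.
  by exfalso; apply: nbm; exists j.
have [i [kji []]] := nab n m (maxn k j).
rewrite geq_max in kji; case/andP: kji => ki ji.
by rewrite !ltW ?hk ?hj ?ler_nat.
Qed.

(** During [0, k] the path stays in a compact subset of the open interval, hence
away from the points b n for large n. *)
Lemma hit_escape (b : (\bar R)^nat) (e : \bar R) : zeta = +oo -> ~ I e ->
  b @ \oo --> e -> forall k : R, exists N, forall n, (N <= n)%N -> forall s, 0 <= s ->
  k%:E <= next_time s [set b n] p.
Proof.
move=> /lifetime_yP zI nIe be k.
have : forall u, (0 <= u <= k)%R -> p u <> e.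
  by move=> u /andP[u0 _] pue; apply: nIe; rewrite -pue; exact: zI.
move=> /(path_avoid_nbhs pP (lexx 0%R)) /be[N _ hN]; exists N => n Nn s s0.
rewrite leNgt; apply/negP => /next_time_lt[u [su uk pub]].
apply: (hN n Nn u) => //; rewrite -lee_fin (le_trans s0) ?ltW//=.
Qed.

End ends_of_paths.

(** A finite lifetime would be a limit of times at which the path is at y, but at
its lifetime the path is at an end. *)
Lemma recurrent_path (R : realType) (l r : \bar R) (p : R -> \bar R) (y : \bar R) :
  absorbed_path l r p -> `]l, r[%classic y ->
  (forall q : rat, (0 <= q)%R -> (ratr q)%:E < next_time 0 [set l; r] p ->
    exists2 u : R, (ratr q < u)%R & p u = y) ->
  `]l, r[%classic (p 0%R) -> next_time 0 [set l; r] p = +oo.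
Proof.
move=> pP Iy h /(lifetime_gt0 pP).
case zE : (next_time _ _ _) => [z||]//; rewrite lte_fin => z0.
have [_ Ez] := next_time_in pP (@closed_ends _ l r) (lexx 0) zE.
have : nbhs (p z) (~` [set y]).
  apply: open_nbhs_nbhs; split; last first.
    by move=> /= pz; have /interior_not_end[_] := Iy; rewrite -pz.
  apply: closed_openC; apply: accessible_closed_set1.
  by apply: hausdorff_accessible; exact: ereal_hausdorff.
move=> /(path_cvg pP (ltW z0)) /nbhs_ballP[e /= e0 he].
have : (Num.max 0 (z - e) < z)%R by rewrite gt_max z0/=; lra.
move=> /rat_in_itvoo[q]; rewrite in_itv/= gt_max => /andP[/andP[q0 eq] qz].
have [||u qu pu] := h q.
- by rewrite -(ler0q R) ltW.
- by rewrite zE lte_fin.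
have u0 : (0 <= u)%R by rewrite ltW// (lt_trans q0).
have uz : (u < z)%R.
  by rewrite -lte_fin -zE; apply/(live_interior pP) => //; rewrite pu.
exfalso; apply: (he u) => //=; last by rewrite in_itv/= u0.
by rewrite /ball/= ltr_norml; apply/andP; split; lra.
Qed.

(** Otherwise the path would stay on the side of b where z lies. *)
Lemma path_crossing (R : realType) (l r : \bar R) (p : R -> \bar R) (s : R) (z b e : \bar R) :
  absorbed_path l r p -> (0 <= s)%R -> p s = z -> z < b < e \/ e < b < z ->
  p t @[t --> +oo%R] --> e -> next_time s%:E [set b] p < +oo.
Proof.
move=> pP s0 psz sep pe; apply: contrapT => nT.
have nb u : (s < u)%R -> p u <> b.
  by move=> su pub; apply: nT; apply/next_time_lt; exists u; rewrite lte_fin ltry.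
have nb' u : (s <= u)%R -> p u <> b.
  rewrite le_eqVlt => /predU1P[<-|/nb//]; rewrite psz => zb; move: sep.
  by rewrite zb !ltxx andbF; case.
have side t : (s <= t)%R -> (forall u, (s <= u <= t)%R -> p u < b) \/
    (forall u, (s <= u <= t)%R -> b < p u).
  by move=> st; apply: (path_avoid pP) => // u /andP[/nb'].
case: sep => /andP[h1 h2].
- have [M [_ hM]] := pe _ (open_ereal_gt' h2).
  have [st Mt] : (s <= Num.max s (M + 1))%R /\ (M < Num.max s (M + 1))%R.
    by rewrite le_max lt_max lexx ltrDl ltr01 orbT.
  have [h|h] := side _ st.
    have := h (Num.max s (M + 1))%R; rewrite st lexx => /(_ isT).
    by rewrite ltNge ltW// hM.
  by have := h s; rewrite lexx st psz => /(_ isT); rewrite ltNge ltW.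
- have [M [_ hM]] := pe _ (open_ereal_lt' h1).
  have [st Mt] : (s <= Num.max s (M + 1))%R /\ (M < Num.max s (M + 1))%R.
    by rewrite le_max lt_max lexx ltrDl ltr01 orbT.
  have [h|h] := side _ st.
    by have := h s; rewrite lexx st psz => /(_ isT); rewrite ltNge ltW.
  have := h (Num.max s (M + 1))%R; rewrite st lexx => /(_ isT).
  by rewrite ltNge ltW// hM.
Qed.

(** * Hitting times and the natural filtration *)

Section optional_times.
Context {R : realType} (l r : \bar R) d (Om : measurableType d).
Notation I := (`]l, r[%classic : set (\bar R)).
Variable X : R -> Om -> \bar R.
Hypothesis XP : forall w, absorbed_path l r (X ^~ w).
Implicit Types (S : Om -> \bar R).

Notation sigma J := (observables X J).-sigma.-measurable.

Lemma umeasurable_id : umeasurable_fun setT (@id (\bar R)).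
Proof.
by move=> B mB mu; rewrite setTI preimage_id; exists B, B; split => //; rewrite setDv measure0.
Qed.

Lemma observable_measurable (J : set R) t : J t ->
  @measurable_fun _ _ (g_sigma_algebraType (observables X J)) _ setT (X t).
Proof.
move=> Jt _ B mB; rewrite setTI; apply: sub_sigma_algebra.
by exists t, id, B; split => //; exact: umeasurable_id.
Qed.

Lemma observables_sub (J K : set R) A : J `<=` K -> sigma J A -> sigma K A.
Proof.
move=> JK; apply: sub_sigma_algebra2 => C [t [f [B [Jt ? ? ?]]]].
by exists t, f, B; split => //; exact: JK.
Qed.

(** Optional times for the filtration that is not made right-continuous.  They
are stopping times of the natural filtration, and unlike stopping times they
are easily seen to be preserved by taking the next hit. *)
Definition optional S := (forall w, 0 <= S w) /\
  forall t : R, (0 < t)%R -> sigma `[0%R, t] [set w | S w < t%:E].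

Definition next_hit S (y : \bar R) (w : Om) := next_time (S w) [set y] (X ^~ w).

Lemma optional_cst (k : R) : (0 <= k)%R -> optional (cst k%:E).
Proof.
move=> k0; split=> [w|t t0]; first by rewrite lee_fin.
by rewrite /cst; have [kt|kt] := boolP (k%:E < t%:E);
  rewrite ?set_true ?set_false//; exact: measurable0.
Qed.

Lemma optional_hit S y : optional S -> I y -> optional (next_hit S y).
Proof.
move=> [S0 mS] Iy; split=> [w|t t0]; first exact: le_trans (le_next_time _ _ _).
pose y0 := fine y; have yE : y = y0%:E by rewrite (interior_fin Iy).
pose H (ab : rat * rat) := [set w | [/\ (ratr ab.2 < t)%R & S w < (ratr ab.1)%:E] ] `&`
  [set w | (0 <= ab.1)%R && (ab.1 < ab.2)%R /\
    forall n : nat, exists2 q : rat, (ab.1 <= q <= ab.2)%R &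
    (y0 - n.+1%:R^-1)%:E < X (ratr q) w < (y0 + n.+1%:R^-1)%:E].
rewrite [X in sigma _ X](_ : _ = \bigcup_ab H ab).
  apply: countable_bigcupT_measurable => // -[a b]; rewrite /H /=.
  have [bt|bt] := boolP (ratr b < t)%R; last first.
    by rewrite [X in X `&` _](_ : _ = set0) ?set0I//; apply/seteqP; split=> w // [].
  have [/andP[a0 ab]|nab] := boolP ((0 <= a) && (a < b))%R; last first.
    by rewrite [X in _ `&` X](_ : _ = set0) ?setI0//; apply/seteqP; split=> w // [].
  have Jq q : (a <= q <= b)%R -> `[0%R, t]%classic (ratr q : R).
    move=> /andP[aq qb]; rewrite /= in_itv/= ler0q (le_trans a0)//=.
    by apply/ltW/le_lt_trans/bt; rewrite ler_rat.
  apply: measurableI.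
    have [a0'|a0'] := eqVneq a 0%R.
      rewrite [X in sigma _ X](_ : _ = set0)//; apply/seteqP; split=> w //= -[_].
      by rewrite a0' raddf0 ltNge S0.
    have ra0 : (0 < ratr a :> R)%R by rewrite ltr0q lt_neqAle eq_sym a0'.
    apply: (@observables_sub `[0%R, ratr a]); last first.
      rewrite [X in sigma _ X](_ : _ = [set w | S w < (ratr a)%:E]); first exact: mS.
      by apply/seteqP; split=> w /= => [[]|].
    move=> u /=; rewrite !in_itv/= => /andP[-> /le_trans ua]/=; apply: ua.
    by apply/ltW/lt_trans/bt; rewrite ltr_rat.
  rewrite [X in sigma _ X](_ : _ = \bigcap_n \bigcup_q
      [set w | (a <= q <= b)%R && ((y0 - n.+1%:R^-1)%:E < X (ratr q) w < (y0 + n.+1%:R^-1)%:E)]).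
    apply: bigcapT_measurable => n; apply: bigcupT_measurable_rat => q.
    have [aqb|_] := boolP (a <= q <= b)%R; last by rewrite set_false; exact: measurable0.
    rewrite /= [X in sigma _ X](_ : _ = setT `&`
      X (ratr q) @^-1` `](y0 - n.+1%:R^-1)%:E, (y0 + n.+1%:R^-1)%:E[%classic).
      by apply: (observable_measurable (Jq _ aqb)) => //; exact: emeasurable_itv.
    by apply/seteqP; split=> w /=; rewrite in_itv//= => -[].
  apply/seteqP; split=> w /=.
    by move=> [_ h] n _; have [q aqb hq] := h n; exists q => //=; rewrite aqb.
  move=> h; split=> // n; by have [q _ /andP[? ?]] := h n Logic.I; exists q.
apply/seteqP; split=> w /=.
  move=> /next_time_lt[u [Su ut Xu]]; rewrite lte_fin in ut.
  have [s sE] : exists s : R, S w = s%:E.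
    exists (fine (S w)); rewrite fineK// ge0_fin_numE//.
    by rewrite (lt_trans Su)// ltry.
  have s0 : (0 <= s)%R by rewrite -lee_fin -sE.
  rewrite sE lte_fin in Su.
  have [a /=] := rat_in_itvoo Su; rewrite in_itv/= => /andP[sa au].
  have [b /=] := rat_in_itvoo ut; rewrite in_itv/= => /andP[ub bt].
  have ab : (a < b)%R by rewrite -(ltr_rat R) (lt_trans au).
  have a0 : (0 <= a)%R by rewrite -(ler0q R) (le_trans s0)// ltW.
  exists (a, b) => //=; split; first by split => //; rewrite sE lte_fin.
  rewrite a0 ab; split => //; apply/(path_hits_rat (XP w)) => //.
  by exists u; [rewrite !ltW|rewrite -yE].
move=> [[a b] _ /= [[bt Sa] [/andP[a0 ab] h]]].
have /(path_hits_rat (XP w) y0 a0 ab)[u /andP[au ub] Xu] := h.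
apply/next_time_lt; exists u; split; last by rewrite yE.
- by apply: lt_le_trans Sa _; rewrite lee_fin.
- by rewrite lte_fin; exact: le_lt_trans bt.
Qed.

Lemma optional_stopping S : optional S -> stopping_time (natural_filtration X) S.
Proof.
move=> [S0 mS]; split => // t t0 u /= tu.
rewrite [X in <<s _ >> X](_ : _ =
    \bigcap_n [set w | S w < (Num.min u (t + n.+1%:R^-1)%R)%:E]).
  apply: (@bigcapT_measurable _ (g_sigma_algebraType (observables X `[0%R, u]))).
  move=> n; set v := Num.min _ _.
  have v0 : (0 < v)%R by rewrite lt_min (le_lt_trans t0)//= ltr_wpDl.
  apply: (@observables_sub `[0%R, v]); last exact: mS.
  by move=> x /=; rewrite !in_itv/= => /andP[-> xv]; rewrite (le_trans xv)// ge_min lexx.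
apply/seteqP; split=> w /=.
  move=> St n _; apply: le_lt_trans St _; rewrite lte_fin lt_min tu/=.
  by rewrite ltrDl.
move=> h; apply/lee_addgt0Pr => e e0.
have [n ne] : exists n : nat, (n.+1%:R^-1 < e)%R.
  exists (Num.truncn e^-1); rewrite invf_plt ?posrE//.
  exact: truncnS_gt.
apply: ltW; apply: lt_trans (h n Logic.I) _; rewrite -EFinD lte_fin.
by rewrite gt_min ltrD2l ne orbT.
Qed.

End optional_times.

(** * Recurrent diffusions *)

Section diffusion_basics.
Context {R : realType} {l r : \bar R} {d : measure_display}.
Context {Om : measurableType d} (X : diffusion l r Om).
Notation I := (`]l, r[%classic : set (\bar R)).
Notation zeta := (lifetime l r X).

Lemma diffusion_path w : absorbed_path l r (X ^~ w).
Proof.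
split=> [t t0|//|s t st]; first exact: path_range.
- exact: path_continuous.
- exact: path_absorbed st.
Qed.

Lemma hitE y : hit X y = next_hit X (cst 0) y.
Proof. by []. Qed.

Lemma live_iff (t : R) w : (0 <= t)%R -> t%:E < zeta w <-> I (X t w).
Proof. exact: live_interior (diffusion_path w) t. Qed.

Lemma filtE t : (0 <= t)%R -> (filt X t).-sigma.-measurable = filt X t.
Proof. by move=> /(filt_sigma_algebra X)[/measurable_g_measurableTypeE]. Qed.

Lemma filt_measurable t A : (0 <= t)%R -> filt X t A -> measurable A.
Proof. by move=> /(filt_sigma_algebra X)[_]; apply. Qed.

Lemma observables_filt t A : (0 <= t)%R ->
  (observables X `[0%R, t]).-sigma.-measurable A -> filt X t A.
Proof.
move=> t0; apply: smallest_sub; last exact: path_adapted.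
by case: (filt_sigma_algebra X t0).
Qed.

Lemma natural_filt t A : (0 <= t)%R -> natural_filtration X t A -> filt X t A.
Proof.
move=> t0 nA; apply: filt_right_continuous => // u /= tu.
by apply: observables_filt (nA u tu); exact: le_trans (ltW tu).
Qed.

Lemma stopping_natural T :
  stopping_time (natural_filtration X) T -> stopping_time (filt X) T.
Proof. by move=> [T0 mT]; split=> // t t0; apply: natural_filt (mT t t0). Qed.

Lemma path_measurable t : (0 <= t)%R -> measurable_fun setT (X t).
Proof.
move=> t0 _ B mB; apply: (filt_measurable t0); apply: observables_filt => //.
by apply: observable_measurable => //=; rewrite in_itv/= t0 lexx.
Qed.

Lemma optional_measurable T (t : R) : optional X T -> measurable [set w | T w < t%:E].
Proof.
move=> [T0 mT]; have [t0|t0] := ltP 0%R t.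
  by apply: (filt_measurable (ltW t0)); apply: observables_filt (mT t t0); exact: ltW.
rewrite [X in measurable X](_ : _ = set0)//; apply/seteqP; split=> w //=.
by rewrite ltNge (le_trans _ (T0 w)).
Qed.

Lemma lty_bigcup (T : Om -> \bar R) : (forall w, 0 <= T w) ->
  [set w : Om | T w < +oo] = \bigcup_n [set w | T w < n%:R%:E].
Proof.
move=> T0; apply/seteqP; split=> w /=; last first.
  by move=> [n _ /= /lt_trans]; apply; exact: ltry.
move=> Too; exists (Num.truncn (fine (T w))).+1 => //=.
by rewrite -(fineK (x := T w)) ?ge0_fin_numE// lte_fin truncnS_gt.
Qed.

Lemma optional_lty_measurable T : optional X T -> measurable [set w | T w < +oo].
Proof.
move=> oT; rewrite lty_bigcup; last by case: oT.
by apply: bigcupT_measurable => n; exact: optional_measurable.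
Qed.

Lemma cst_stopping t : (0 <= t)%R -> stopping_time (filt X) (cst t%:E).
Proof.
by move=> t0; apply: stopping_natural; apply: optional_stopping; exact: optional_cst.
Qed.

Lemma cst_stopped t G : (0 <= t)%R -> filt X t G ->
  stopped_sigma (filt X) (cst t%:E) G.
Proof.
move=> t0 FG; split.
  by apply: sub_sigma_algebra; exists t => //=; rewrite in_itv/= t0.
move=> s s0; rewrite /cst lee_fin; have [ts|ts] := boolP (t <= s)%R.
  by rewrite set_true// setIT; apply: filt_homo FG; rewrite t0.
by rewrite set_false// setI0 -filtE.
Qed.

Lemma setT_stopped T : stopping_time (filt X) T -> stopped_sigma (filt X) T setT.
Proof.
move=> [_ mT]; split; last by move=> t t0; rewrite setTI; exact: mT.
exact: (@measurableT _ (g_sigma_algebraType _)).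
Qed.

Lemma live_measurable t : (0 <= t)%R -> measurable [set w | t%:E < zeta w].
Proof.
move=> t0; rewrite [X in measurable X](_ : _ = X t @^-1` I).
  rewrite -[X in measurable X]setTI; apply: path_measurable => //.
  exact: emeasurable_itv.
by apply/seteqP; split=> w /= /(live_iff _ t0).
Qed.

Lemma markov_measurable t C : (0 <= t)%R -> measurable C ->
  measurable ([set w | t%:E < zeta w] `&` [set w | C (Defs.shift X t w)]).
Proof. by move=> t0 mC; have [] := strong_markov (cst_stopping t0) mC. Qed.

Lemma markov t C x G : (0 <= t)%R -> measurable C -> I x -> filt X t G ->
  law X x (G `&` ([set w | t%:E < zeta w] `&` [set w | C (Defs.shift X t w)])) =
  \int[law X x]_(w in G `&` [set w | t%:E < zeta w]) law X (X t w) C.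
Proof.
move=> t0 mC Ix FG; have [_] := strong_markov (cst_stopping t0) mC.
by move=> /(_ x G Ix (cst_stopped t0 FG)).
Qed.

Lemma law_start_ae x : I x -> {ae law X x, forall w, X 0%R w = x}.
Proof.
move=> Ix; apply: (@probability1_ae _ _ _ _ [set w | X 0%R w = x]).
  rewrite [X in measurable X](_ : _ = setT `&` X 0%R @^-1` [set x]).
    by apply: path_measurable => //; exact: emeasurable_set1.
  by rewrite setTI.
exact: law_start.
Qed.

Hypothesis X_rec : recurrent X (fun x => law X x).

Lemma hit_optional y : I y -> optional X (hit X y).
Proof.
move=> Iy; rewrite hitE; apply: (optional_hit diffusion_path) => //.
exact: (@optional_cst _ _ _ _ 0%R).
Qed.

(** For every rational q, on q < zeta the path returns to x after q, by the Markov
property and recurrence. *)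
Lemma lifetime_infinite x : I x -> {ae law X x, forall w, zeta w = +oo}.
Proof.
move=> Ix; have mH := optional_lty_measurable (hit_optional Ix).
have : {ae law X x, forall w, forall q : rat, (0 <= q)%R ->
    (ratr q)%:E < zeta w -> hit X x (Defs.shift X (ratr q) w) < +oo}.
  apply: ae_forall_rat => q; have [q0|q0] := boolP (0 <= q)%R; last exact: aeW.
  have rq0 : (0 <= ratr q :> R)%R by rewrite ler0q.
  have mC := measurableC mH.
  exists ([set w | (ratr q)%:E < zeta w] `&`
    [set w | (~` [set w | hit X x w < +oo]) (Defs.shift X (ratr q) w)]); split.
  - exact: markov_measurable.
  - have fT : filt X (ratr q) setT by rewrite -filtE.
    have := markov rq0 mC Ix fT; rewrite !setTI => E; apply: (etrans E).
    apply: integral0_eq => w /= /(live_iff _ rq0) Iw.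
    by rewrite probability_setC// X_rec// subee.
  - by move=> w /= /not_implyP[_] /not_implyP[].
apply: filterS2 (law_start_ae Ix) => w X0 h.
apply: (recurrent_path (y := x) (diffusion_path w)) => //; last by rewrite X0.
move=> q q0 qz; have /(next_time_lt 0 [set x] _ _)[u [u0 _ Xu]] := h q q0 qz.
exists (ratr q + u)%R; first by rewrite ltrDl -lte_fin.
by rewrite -path_shift ?ler0q// -lee_fin ltW.
Qed.

Lemma hit_finite x y : I x -> I y -> {ae law X x, forall w, hit X y w < +oo}.
Proof.
move=> Ix Iy; apply: (@probability1_ae _ _ _ _ [set w | hit X y w < +oo]).
  exact: optional_lty_measurable (hit_optional Iy).
exact: X_rec.
Qed.

Lemma late_hits x (b : (\bar R)^nat) (e k : \bar R) : I x -> (forall n, I (b n)) ->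
  b @ \oo --> e -> ~ I e -> 0 < k -> forall t : R,
  exists n, law X x [set w | hit X (b n) w < t%:E] < k.
Proof.
move=> Ix Ib be nIe k0 t; apply: contrapT => nk.
have : k <= law X x set0.
  apply: (@le_limsup_probability _ _ _ _ _ (fun n => [set w | hit X (b n) w < t%:E])) => //.
  - by move=> n; apply: optional_measurable; exact: hit_optional.
  - by move=> n; rewrite leNgt; apply/negP => h; apply: nk; exists n.
  apply: filterS (lifetime_infinite Ix) => w zw.
  have [N hN] := hit_escape (diffusion_path w) zw nIe be t.
  by move=> /(_ N)[n Nn /=]; rewrite ltNge => /negP; apply; exact: (hN n Nn 0 (lexx 0)).
by rewrite measure0 leNgt k0.
Qed.

End diffusion_basics.

(** * Additive functionals *)

Section additive_functional.
Context {R : realType} {l r : \bar R} {d : measure_display}.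
Context {Om : measurableType d} (X : diffusion l r Om).
Notation I := (`]l, r[%classic : set (\bar R)).
Notation zeta := (lifetime l r X).
Hypothesis X_rec : recurrent X (fun x => law X x).
Variable A : R -> Om -> \bar R.
Hypothesis A_pcaf : pcaf X A.

Lemma af_ge0 t w : (0 <= t)%R -> 0 <= A t w.
Proof. by case: A_pcaf => + _ _ _; apply. Qed.

Lemma af_filt t B : (0 <= t)%R -> measurable B -> filt X t (A t @^-1` B).
Proof. by case: A_pcaf => _ + _ _; apply. Qed.

Lemma af_measurable t : (0 <= t)%R -> measurable_fun setT (A t).
Proof.
by move=> t0 _ B mB; rewrite setTI; apply: (@filt_measurable _ _ _ _ _ X _ _ t0); exact: af_filt.
Qed.

(** What [pcaf_path] says for an infinite lifetime. *)
Definition regular_af (a : R -> \bar R) :=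
  [/\ forall s t : R, (0 <= s <= t)%R -> a s <= a t,
      forall t : R, (0 <= t)%R -> a t \is a fin_num &
      {within `[0%R, +oo[, continuous a}].

Lemma af_regular x : I x -> {ae law X x, forall w, regular_af (A ^~ w)}.
Proof.
move=> Ix; case: A_pcaf => _ _ /(_ x Ix) Ap _.
apply: filterS2 (lifetime_infinite X_rec Ix) Ap => w zw [Am Af Ac _]; split => //.
  by move=> t t0; apply: Af => //; rewrite zw ltry.
rewrite (_ : `[0%R, +oo[%classic = [set t : R | (0 <= t)%R /\ t%:E < zeta w])//.
by apply/seteqP; split=> t /=; rewrite in_itv/= andbT zw ltry; [|case].
Qed.

Lemma af_additive x s t : I x -> (0 <= s)%R -> (0 <= t)%R ->
  {ae law X x, forall w, A (t + s)%R w = A t w + A s (Defs.shift X t w)}.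
Proof. by case: A_pcaf => _ _ _; apply. Qed.

(** Additivity at the times 0 and 0 gives A_0 = 0 after the shift by 0, and this
shift preserves [law X x] by the Markov property. *)
Lemma af0 x : I x -> {ae law X x, forall w, A 0%R w = 0}.
Proof.
move=> Ix; have mC : measurable [set w | A 0%R w = 0].
  rewrite [X in measurable X](_ : _ = setT `&` A 0%R @^-1` [set 0]).
    by apply: af_measurable => //; exact: emeasurable_set1.
  by rewrite setTI.
apply: (@probability1_ae _ _ _ _ [set w | A 0%R w = 0]) => //.
apply/eqP; rewrite eq_le probability_le1//=.
have fT : filt X 0%R setT by rewrite -filtE.
have := markov (lexx 0%R) mC Ix fT; rewrite !setTI => E.
have {}E : 1 = \int[law X x]_(w in [set w | 0 < zeta w]) law X (X 0%R w) [set w | A 0%R w = 0].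
  rewrite -E -(probability_setT (law X x)); apply: eq_measure_ae => //.
    exact: markov_measurable.
  apply: filterS3 (lifetime_infinite X_rec Ix) (af_regular Ix)
    (af_additive Ix (lexx 0%R) (lexx 0%R)) => w zw [_ /(_ 0%R (lexx 0%R)) Af _].
  rewrite addr0 => A0; split => // _; split; first by rewrite /= zw ltry.
  move: A0; rewrite /= -[in X in X -> _](fineK Af); case: (A 0%R (Defs.shift X 0%R w)) => //.
  by move=> u [Au]; congr (_%:E); lra.
rewrite {1}E -[leRHS]mule1 -(probability_setT (law X x)) -integral_cst//.
apply: ge0_le_integral_ae => //.
by apply: filterS (law_start_ae X Ix) => w ->.
Qed.

(** The event that A_oo <= c, almost surely; integer times keep it measurable. *)
Definition af_below (c : R) := [set w | forall n : nat, A n%:R w <= c%:E].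

Definition af_below_after (h c : R) :=
  [set w | forall n : nat, A (n%:R + h)%R w <= A h w + c%:E].

Lemma af_below_measurable c : measurable (af_below c).
Proof.
rewrite [X in measurable X](_ : _ = \bigcap_n (setT `&` A n%:R @^-1` `]-oo, c%:E]%classic)).
  apply: bigcapT_measurable => n; apply: af_measurable => //.
  exact: emeasurable_itv.
apply/seteqP; split=> w /=; first by move=> h n _; split=> //=; rewrite in_itv/=.
by move=> h n; have [_ /=] := h n Logic.I; rewrite in_itv/=.
Qed.

Lemma af_below_after_measurable h c : (0 <= h)%R -> measurable (af_below_after h c).
Proof.
move=> h0; rewrite [X in measurable X](_ : _ = \bigcap_n
    (setT `&` [set w | A (n%:R + h)%R w <= A h w + c%:E])).
  apply: bigcapT_measurable => n; apply: emeasurable_fun_le => //.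
    by apply: af_measurable; rewrite addr_ge0.
  by apply: emeasurable_funD => //; exact: af_measurable.
apply/seteqP; split=> w /= h1 n; last by have [] := h1 n Logic.I.
by move=> _; split => //; exact: h1.
Qed.

Lemma af_below_shift x s c : I x -> (0 <= s)%R ->
  {ae law X x, forall w, af_below c w -> af_below c (Defs.shift X s w)}.
Proof.
move=> Ix s0.
have add : {ae law X x, forall w, forall n : nat,
    A (s + n%:R)%R w = A s w + A n%:R (Defs.shift X s w)}.
  by apply: ae_foralln => n; exact: af_additive.
apply: filterS2 (af_regular Ix) add => w [Am Af _] Aadd Ec n.
have Afs := Af s s0.
have : A s w + A n%:R (Defs.shift X s w) <= c%:E.
  rewrite -Aadd; apply: le_trans (Ec (Num.truncn (s + n%:R)).+1).
  by apply: Am; rewrite addr_ge0//= ltW// truncnS_gt.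
by apply: le_trans; rewrite leeDr// af_ge0.
Qed.

Lemma af_below_after_shift x s h c : I x -> (0 <= s <= h)%R ->
  {ae law X x, forall w, af_below c (Defs.shift X s w) -> af_below_after h c w}.
Proof.
move=> Ix /andP[s0 sh].
have add : {ae law X x, forall w, forall n : nat,
    A (s + n%:R)%R w = A s w + A n%:R (Defs.shift X s w)}.
  by apply: ae_foralln => n; exact: af_additive.
apply: filterS2 (af_regular Ix) add => w [Am Af _] Aadd Ec n.
pose m := (Num.truncn (n%:R + h - s)).+1.
apply: (@le_trans _ _ (A (s + m%:R)%R w)).
  apply: Am; apply/andP; split; first by rewrite addr_ge0// (le_trans s0).
  by rewrite -lerBlDl ltW// truncnS_gt.
rewrite Aadd; apply: leeD; last exact: (Ec m).
by apply: Am; rewrite s0.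
Qed.

Lemma af_below_split x t (e c : R) : I x -> (0 <= t)%R ->
  {ae law X x, forall w, af_below c w -> e%:E < A t w ->
     af_below (c - e) (Defs.shift X t w)}.
Proof.
move=> Ix t0.
have add : {ae law X x, forall w, forall n : nat,
    A (t + n%:R)%R w = A t w + A n%:R (Defs.shift X t w)}.
  by apply: ae_foralln => n; exact: af_additive.
apply: filterS2 (af_regular Ix) add => w [Am Af _] Aadd Ec eA n.
have : A t w + A n%:R (Defs.shift X t w) <= c%:E.
  rewrite -Aadd; apply: le_trans (Ec (Num.truncn (t + n%:R)).+1).
  by apply: Am; rewrite addr_ge0//= ltW// truncnS_gt.
move: eA; rewrite -(fineK (Af t t0)) lte_fin.
case: (A n%:R (Defs.shift X t w)) => [v||]//.
  by rewrite -EFinD !lee_fin => ? ?; lra.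
by move=> _ _; rewrite leNye.
Qed.

(** As h tends to 0, the increment of A after h increases to A, since A starts at
0 and is continuous there. *)
Lemma af_below_limit x c : I x -> forall k,
  (forall h : R, (0 < h)%R -> k <= law X x (af_below_after h c)) ->
  k <= law X x (af_below c).
Proof.
move=> Ix k hk.
apply: (@le_limsup_probability _ _ _ _ _ (fun n => af_below_after n.+1%:R^-1 c)).
- by move=> n; apply: af_below_after_measurable; rewrite invr_ge0.
- exact: af_below_measurable.
- by move=> n; apply: hk; rewrite invr_gt0.
apply: filterS2 (af_regular Ix) (af0 Ix) => w [Am Af Ac] A0 io n.
apply/lee_addgt0Pr => e e0.
have cA : A u w @[u --> within `[0%R, +oo[ (nbhs (0%R : R))] --> 0.
  rewrite -A0; move/subspace_continuousP : Ac; apply.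
  by rewrite /= in_itv/= lexx.
have : nbhs 0 [set y | y < e%:E] by apply: open_ereal_lt'; rewrite lte_fin.
move=> /cA /nbhs_ballP[d0 /= d0_gt0 hd].
have [m mN Em] := io (Num.truncn d0^-1).
have m0 : (0 < m.+1%:R^-1 :> R)%R by rewrite invr_gt0.
have md : (m.+1%:R^-1 < d0)%R.
  rewrite invf_plt ?posrE//; apply: lt_le_trans (truncnS_gt _) _.
  by rewrite ler_nat ltnS.
have Ae : A m.+1%:R^-1%R w < e%:E.
  apply: (hd m.+1%:R^-1%R) => /=; last by rewrite in_itv/= ltW.
  by rewrite /ball/= sub0r normrN gtr0_norm.
apply: (@le_trans _ _ (A (n%:R + m.+1%:R^-1)%R w)).
  by apply: Am; rewrite ler0n/= lerDl ltW.
by apply: le_trans (Em n) _; rewrite addeC leeD// ltW.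
Qed.

End additive_functional.

(** * The law of the total mass of A does not depend on the starting point *)

Section averaging.
Context {R : realType} {l r : \bar R} {d : measure_display}.
Context {Om : measurableType d} (X : diffusion l r Om).
Notation I := (`]l, r[%classic : set (\bar R)).
Notation zeta := (lifetime l r X).

(** Defined for negative times too, to be measurable on a whole product space. *)
Definition path_at (p : measurableTypeR R * Om) : \bar R := X (Num.max 0%R p.1) p.2.

(** By continuity the path is the limit of its values on finer and finer grids of
times. *)
Lemma path_at_measurable : measurable_fun setT path_at.
Proof.
pose grid (n : nat) (t : R) : R := ((Num.truncn (n.+1%:R * Num.max 0 t)).+1%:R / n.+1%:R)%R.
have grid0 n t : (0 <= grid n t)%R by rewrite divr_ge0.
apply: (emeasurable_fun_cvg (fun n p => X (grid n p.1) p.2)) => [n _ B mB|[t w] _].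
  rewrite setTI [X in measurable X](_ : _ = \bigcup_k
    ([set t : measurableTypeR R | (k%:R <= n.+1%:R * Num.max 0%R t < k.+1%:R)%R] `*`
     (X (k.+1%:R / n.+1%:R)%R @^-1` B))).
    apply: bigcupT_measurable => k; apply: measurableX.
      rewrite [X in measurable X](_ : _ = setT `&`
        (fun t : measurableTypeR R => n.+1%:R * Num.max 0 t)%R @^-1` `[k%:R, k.+1%:R[%classic).
        have mf : measurable_fun [set: measurableTypeR R]
            (fun t : measurableTypeR R => n.+1%:R * Num.max 0 t)%R.
          by apply: measurable_funM => //; exact: measurable_maxr.
        exact: mf.
      by apply/seteqP; split=> t /=; rewrite in_itv//= => -[].
    by rewrite -[X in measurable X]setTI; apply: path_measurable.
  have m0 (t : R) : (0 <= n.+1%:R * Num.max 0 t)%R by rewrite mulr_ge0// le_max lexx.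
  apply/seteqP; split=> -[t w] /=.
    move=> Bt; exists (Num.truncn (n.+1%:R * Num.max 0 t)%R) => //=.
    by split=> //; exact: truncn_itv.
  by move=> [k _ [/= kt Bk]]; rewrite /grid (truncn_def kt).
rewrite /path_at/=; set s := Num.max 0%R t.
have s0 : (0 <= s)%R by rewrite le_max lexx.
have gs : grid ^~ t @ \oo --> s.
  apply/cvgrPdist_le => e e0; exists (Num.truncn e^-1) => // n /= en.
  have /andP[h1 h2] : ((Num.truncn (n.+1%:R * s))%:R <= n.+1%:R * s <
      (Num.truncn (n.+1%:R * s)).+1%:R)%R by apply: truncn_itv; rewrite mulr_ge0.
  have n0 : (0 < n.+1%:R :> R)%R by [].
  have e1 : (n.+1%:R^-1 <= e)%R.
    rewrite invf_ple ?posrE// ltW//; apply: lt_le_trans (truncnS_gt _) _.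
    by rewrite ler_nat.
  rewrite distrC ger0_norm; last first.
    by rewrite subr_ge0 ler_pdivlMr// mulrC ltW.
  apply: le_trans e1; rewrite lerBlDr ler_pdivrMr// mulrDl mulVf ?gt_eqF//.
  by rewrite -natr1 addrC lerD2l [leRHS]mulrC.
move=> U /(path_cvg (diffusion_path X w) s0) nU.
have {}nU : \forall u \near s, (0 <= u)%R -> U (X u w).
  move: (nU : \forall u \near s, `[0%R, +oo[%classic u -> U (X u w)).
  by apply: filterS => u /= h u0; apply: h; rewrite in_itv/= u0.
have {}nU : \forall n \near \oo, (0 <= grid n t)%R -> U (X (grid n t) w) := gs _ nU.
suff : \forall n \near \oo, U (X (grid n t) w) by [].
by apply: filterS nU => n; apply.
Qed.

Hypothesis X_rec : recurrent X (fun x => law X x).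

Lemma optional_fun_measurable T : optional X T -> measurable_fun setT T.
Proof.
move=> oT mD; apply: (measurability _ (ErealGenInftyO.measurableE R)) => //.
move=> _ [_ [x ->] <-]; rewrite setTI.
rewrite [X in measurable X](_ : _ = [set w | T w < x%:E]); first exact: (optional_measurable x oT).
by apply/seteqP; split=> w /=; rewrite in_itv/=.
Qed.

(** The strong Markov property for events of the shifted path; since X is at y at
the hitting time, the integral that it involves is of a constant. *)
Lemma law_after_hit z y C : I z -> I y -> measurable C ->
  let T := hit X y in
  let after := [set w | T w < zeta w] `&` [set w | C (Defs.shift X (fine (T w)) w)] in
  measurable after /\ law X z after = law X y C.
Proof.
move=> Iz Iy mC T after.
have sT : stopping_time (filt X) T.
  exact: stopping_natural (optional_stopping (hit_optional X Iy)).
have [mafter] := strong_markov sT mC; split => //.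
have := b z setT Iz (setT_stopped sT); rewrite !setTI => ->.
have mlive : measurable [set w | T w < zeta w].
  rewrite [Y in measurable Y](_ : _ = [set w | T w < +oo]).
    exact: optional_lty_measurable (hit_optional X Iy).
  have h w := hit_lt_lifetime (diffusion_path X w) (lexx 0) Iy.
  by apply/seteqP; split=> w /= Tw; [exact: (h w).2|exact: (h w).1].
transitivity (\int[law X z]_(w in [set w | T w < zeta w]) cst (law X y C) w).
  apply: eq_integral => w /set_mem /= Tz.
  rewrite (path_at_hit (diffusion_path X w) (lexx 0)) //.
  exact: lt_le_trans Tz (leey _).
rewrite integral_cst// -[RHS]mule1; congr (_ * _).
rewrite -(probability_setT (law X z)); apply: eq_measure_ae => //.
apply: filterS2 (lifetime_infinite X_rec Iz) (hit_finite X_rec Iz Iy) => w zw Tw.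
by split => // _; rewrite /= zw.
Qed.

(** The shift disappears, being visible through the positions of X only, and the
position after the hitting time is a Borel function of time and path. *)
Lemma path_after_hit z y (s : R) (f : \bar R -> \bar R) : I z -> I y -> (0 <= s)%R ->
  measurable_fun setT f -> (forall x, 0 <= f x) ->
  \int[law X z]_w f (path_at (s + fine (hit X y w), w)%R) =
  \int[law X y]_w f (path_at (s, w)).
Proof.
move=> Iz Iy s0 mf f0.
have mT : measurable_fun setT (fun w => fine (hit X y w)).
  apply: measurableT_comp => //; apply: optional_fun_measurable.
  exact: hit_optional.
have m1 : measurable_fun setT (fun w => path_at (s + fine (hit X y w), w)%R).
  apply: (measurableT_comp path_at_measurable).
  apply: measurable_fun_pair => //; exact: measurable_funD.
have m2 : measurable_fun setT (fun w => path_at (s, w)).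
  exact: (measurableT_comp path_at_measurable).
transitivity (\int[pushforward (law X z) (fun w => path_at (s + fine (hit X y w), w)%R)]_x f x).
  by rewrite ge0_integral_pushforward.
transitivity (\int[pushforward (law X y) (fun w => path_at (s, w))]_x f x); last first.
  by rewrite ge0_integral_pushforward.
apply: eq_measure_integral => B mB _.
rewrite /pushforward.
have mC : measurable ((fun w => path_at (s, w)) @^-1` B).
  by rewrite -[Y in measurable Y]setTI; exact: m2.
have [ma E] := law_after_hit Iz Iy mC; apply: etrans E.
apply: (@eq_measure_ae _ _ _ (law X z)) => //; first by rewrite -[Y in measurable Y]setTI; exact: m1.
apply: filterS2 (lifetime_infinite X_rec Iz) (hit_finite X_rec Iz Iy) => w zw Tw.
have T0 : (0 <= fine (hit X y w))%R.
  by apply: fine_ge0; exact: le_next_time.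
rewrite /path_at/= !max_r ?addr_ge0// path_shift// addrC.
by split=> [?|[]//]; split => //; rewrite zw.
Qed.

End averaging.

Section comparison.
Context {R : realType} {l r : \bar R} {d : measure_display}.
Context {Om : measurableType d} (X : diffusion l r Om).
Notation I := (`]l, r[%classic : set (\bar R)).
Notation zeta := (lifetime l r X).
Hypothesis X_rec : recurrent X (fun x => law X x).
Variable A : R -> Om -> \bar R.
Hypothesis A_pcaf : pcaf X A.
Variables (z y : \bar R) (c h : R).
Hypotheses (Iz : I z) (Iy : I y) (h0 : (0 < h)%R).

Let lam : {sigma_finite_measure set (measurableTypeR R) -> \bar R} := @lebesgue_measure R.
Let E := af_below A c.
Let T := hit X y.
Let mE : measurable E := af_below_measurable A_pcaf c.
Let mT : measurable_fun setT T := optional_fun_measurable (hit_optional X Iy).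

(* the windows of times [0, h[ and [T, T + h[ *)
Let fresh : set (measurableTypeR R * Om) := [set p | (0 <= p.1 < h)%R].
Let window : set (measurableTypeR R * Om) := [set p | T p.2 <= p.1%:E < T p.2 + h%:E].

Let lam_itv : lam `[0%R, h[%classic = h%:E.
Proof.
transitivity (@lebesgue_measure R `[0%R, h[%classic); first by [].
by rewrite lebesgue_measure_itv/= lte_fin h0 oppr0 adde0.
Qed.

Let fresh_measurable : measurable fresh.
Proof.
rewrite [Y in measurable Y](_ : _ = `[0%R, h[%classic `*` setT).
  by apply: measurableX => //; exact: measurable_itv.
by apply/seteqP; split=> -[s w] /=; rewrite in_itv//= => -[].
Qed.

Let window_measurable : measurable window.
Proof.
have m1 : measurable_fun [set: measurableTypeR R * Om] (fun p => p.1%:E).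
  by apply/measurable_EFinP; exact: measurable_fst.
have m2 : measurable_fun [set: measurableTypeR R * Om] (fun p => T p.2).
  by apply: measurableT_comp => //; exact: measurable_snd.
have m3 : measurable_fun [set: measurableTypeR R * Om] (fun p => T p.2 + h%:E).
  exact: emeasurable_funD.
rewrite [Y in measurable Y](_ : _ = (setT `&` [set p | T p.2 <= p.1%:E]) `&`
   (setT `&` [set p | p.1%:E < T p.2 + h%:E])).
  by apply: measurableI; [exact: emeasurable_fun_le|exact: measurable_lte].
by apply/seteqP; split=> p /=; [case/andP|case=> -[_ h1] [_ h2]; apply/andP].
Qed.

Let T_ge0 w : 0 <= T w. Proof. exact: le_next_time. Qed.

Let windowE w s : T w < +oo -> window (s, w) = (fine (T w) <= s < fine (T w) + h)%R.
Proof.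
move=> Tw; rewrite /window/= -[in RHS]lee_fin -[in RHS]lte_fin EFinD.
by rewrite fineK// ge0_fin_numE.
Qed.

Let window_length w : T w < +oo ->
  \int[lam]_s (\1_window (s, w))%:E = h%:E.
Proof.
move=> Tw; rewrite (_ : (fun s => (\1_window (s, w))%:E) =
    (fun s => (\1_(`[fine (T w), fine (T w) + h[%classic) s)%:E)); last first.
  apply/funext => s; rewrite !indicE; congr (_%:R%:E); congr nat_of_bool.
  by apply/idP/idP; rewrite !in_setE windowE//= in_itv.
rewrite integral_indic//.
rewrite setIT /lam /= lebesgue_measure_itv/= lte_fin ltrDl h0 -EFinD.
by congr (_%:E); lra.
Qed.

Let below_window (p : measurableTypeR R * Om) : \bar R := (\1_(window `&` (setT `*` E)) p)%:E.

Let below_window_measurable : measurable_fun setT below_window.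
Proof.
by apply/measurable_EFinP; apply: measurable_indic; apply: measurableI => //; exact: measurableX.
Qed.

Let below_window_ge0 p : 0 <= below_window p. Proof. by rewrite lee_fin. Qed.

(* The inequality to be proved, multiplied by the length of the window. *)
Let occupation_of_window : h%:E * law X z E <= \int[lam]_s \int[law X z]_w below_window (s, w).
Proof.
rewrite (fubini_tonelli below_window)//.
rewrite -(setIT E) -integral_indic// -ge0_integralZl_EFin//; last 2 first.
- by apply/measurable_EFinP; exact: measurable_indic.
- exact: ltW.
apply: ge0_le_integral_ae => [w _|w _|].
- by rewrite mule_ge0// lee_fin// ltW.
- exact: integral_ge0.
apply: filterS (hit_finite X_rec Iz Iy) => w Tw _; split=> //.
rewrite indicE; have [Ew|_] := boolP (w \in E); last by rewrite mule0 integral_ge0.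
rewrite mule1 -(window_length Tw); apply: le_integral_lower => s _.
rewrite lee_fin ler0n/= /below_window lee_fin !indicE in_setI.
rewrite [X in (_ && X)](_ : _ = true) ?andbT//.
by apply/mem_set; split => //; exact: set_mem.
Qed.

Section with_upper_bound.
Variables (v1 v2 : \bar R -> \bar R).
Hypotheses (mv1 : measurable_fun setT v1) (mv2 : measurable_fun setT v2)
  (v1_ge0 : forall x, 0 <= v1 x) (v2_ge0 : forall x, 0 <= v2 x)
  (v1_le : forall x, I x -> v1 x <= law X x E)
  (v2_ge : forall x, I x -> law X x E <= v2 x).

Let upper_window (p : measurableTypeR R * Om) : \bar R := ((v2 \o path_at X) \_ window) p.
Let upper_shifted (p : measurableTypeR R * Om) : \bar R :=
  ((fun p => v2 (path_at X (p.1 + fine (T p.2), p.2)%R)) \_ fresh) p.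
Let upper_fresh (p : measurableTypeR R * Om) : \bar R := ((v2 \o path_at X) \_ fresh) p.
Let lower_fresh (p : measurableTypeR R * Om) : \bar R := ((v1 \o path_at X) \_ fresh) p.

Let upper_window_ge0 p : 0 <= upper_window p. Proof. by apply: erestrict_ge0 => ? _ /=. Qed.
Let upper_shifted_ge0 p : 0 <= upper_shifted p. Proof. by apply: erestrict_ge0 => ? _ /=. Qed.
Let upper_fresh_ge0 p : 0 <= upper_fresh p. Proof. by apply: erestrict_ge0 => ? _ /=. Qed.
Let lower_fresh_ge0 p : 0 <= lower_fresh p. Proof. by apply: erestrict_ge0 => ? _ /=. Qed.

Let upper_window_measurable : measurable_fun setT upper_window.
Proof.
apply: measurable_patch => //.
by apply: measurableT_comp => //; exact: path_at_measurable.
Qed.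

Let upper_shifted_measurable : measurable_fun setT upper_shifted.
Proof.
apply: measurable_patch => //.
apply: measurableT_comp => //; apply: (measurableT_comp (path_at_measurable X)).
apply: measurable_fun_pair; last exact: measurable_snd.
apply: measurable_funD; first exact: measurable_fst.
apply: (measurableT_comp (f := fine)) => //.
by apply: measurableT_comp => //; exact: measurable_snd.
Qed.

Let upper_fresh_measurable : measurable_fun setT upper_fresh.
Proof.
apply: measurable_patch => //.
by apply: measurableT_comp => //; exact: path_at_measurable.
Qed.

Let lower_fresh_measurable : measurable_fun setT lower_fresh.
Proof.
apply: measurable_patch => //.
by apply: measurableT_comp => //; exact: path_at_measurable.
Qed.

Let lower_markov :
  \int[lam]_s \int[law X y]_w lower_fresh (s, w) <= h%:E * law X y (af_below_after A h c).
Proof.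
have mEh := af_below_after_measurable A_pcaf c (ltW h0).
have -> : h%:E * law X y (af_below_after A h c) =
    \int[lam]_(s in `[0%R, h[) cst (law X y (af_below_after A h c)) s.
  have mh : measurable (`[0%R, h[%classic : set (measurableTypeR R)) by exact: measurable_itv.
  rewrite (integral_cst lam mh (law X y (af_below_after A h c))).
  by rewrite muleC; congr (_ * _); exact: (esym lam_itv).
rewrite [leRHS]integral_mkcond; apply: le_integral_lower => s _.
rewrite integral_ge0//= /patch; case: ifPn => [/set_mem|nS]; last first.
  rewrite integral0_eq// => w _; rewrite /lower_fresh /patch memNset//.
  by move=> Ss; move/negP: nS; apply; apply/mem_set; rewrite /= in_itv.
rewrite /= in_itv/= => /andP[s0 sh].
have fT : filt X s setT by rewrite -filtE.
apply: (@le_trans _ _ (law X y ([set w | s%:E < zeta w] `&` [set w | E (Defs.shift X s w)]))).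
  have := markov s0 mE Iy fT; rewrite !setTI => ->.
  apply: ge0_le_integral_ae => //.
  apply: filterS (lifetime_infinite X_rec Iy) => w zw _.
  have sz : s%:E < zeta w by rewrite zw ltry.
  split=> //; rewrite /lower_fresh /patch mem_set/=; last by rewrite /fresh/= s0.
  by rewrite /path_at/= max_r//; apply: v1_le; exact/(live_iff X).
apply: le_measure_ae => //; first exact: markov_measurable.
have s0h : (0 <= s <= h)%R by rewrite s0 ltW.
by apply: filterS (af_below_after_shift X_rec A_pcaf c Iy s0h) => w h1 [_ /h1].
Qed.

(* The Markov property at the deterministic time s; the event that s belongs to
   the window is known at time s. *)
Let markov_in_window :
  \int[lam]_s \int[law X z]_w below_window (s, w) <=
  \int[lam]_s \int[law X z]_w upper_window (s, w).
Proof.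
apply: le_integral_lower => s _; apply/andP; split; first exact: integral_ge0.
have [s0|s0] := ltP s 0%R.
  rewrite integral0_eq ?integral_ge0// => w _; rewrite /below_window indicE memNset//.
  move=> -[/andP[Ts _] _]; move: Ts; rewrite leNgt => /negP; apply.
  by apply: lt_le_trans (T_ge0 w); rewrite lte_fin.
pose G := [set w | T w <= s%:E < T w + h%:E].
have oT := hit_optional X Iy.
have sT := stopping_natural (optional_stopping oT).
have FG : filt X s G.
  have started : filt X s [set w | T w <= s%:E] by case: sT => _; apply.
  have ended : filt X s [set w | T w + h%:E <= s%:E].
    rewrite [Y in filt X s Y](_ : _ = [set w | T w <= (s - h)%:E]); last first.
      by apply/seteqP; split=> w /=; rewrite EFinB leeBrDr.
    have [sh|sh] := leP h s.
      apply: (@filt_homo _ _ _ _ _ X (s - h)%R); first by rewrite subr_ge0 sh/= gerBl ltW.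
      by case: sT => _; apply; rewrite subr_ge0.
    rewrite [Y in filt X s Y](_ : _ = set0); first by rewrite -filtE.
    apply/seteqP; split=> w //=; rewrite leNgt => /negP; apply.
    by apply: lt_le_trans (T_ge0 w); rewrite lte_fin subr_lt0.
  rewrite (_ : G = [set w | T w <= s%:E] `\` [set w | T w + h%:E <= s%:E]).
    by move: started ended; rewrite -filtE//; exact: measurableD.
  apply/seteqP; split=> w /=.
    by move=> /andP[-> h1]; split=> //; apply/negP; rewrite -ltNge.
  by case=> h1 /negP; rewrite -ltNge => h2; apply/andP.
have mG := filt_measurable s0 FG.
have -> : \int[law X z]_w below_window (s, w) = law X z (G `&` E).
  rewrite -(setIT (G `&` E)) -integral_indic//; last exact: measurableI.
  apply: eq_integral => w _; rewrite /below_window !indicE; congr (_%:R%:E); congr nat_of_bool.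
  by apply/idP/idP; rewrite !in_setE => -[h1 h2]; split => //; case: h2.
have -> : \int[law X z]_w upper_window (s, w) = \int[law X z]_(w in G) v2 (X s w).
  rewrite [RHS]integral_mkcond; apply: eq_integral => w _; rewrite /upper_window /patch.
  rewrite (_ : ((s, w) \in window) = (w \in G)); last first.
    by apply/idP/idP; rewrite !in_setE.
  by case: ifP => // _; rewrite /path_at/= max_r.
apply: (@le_trans _ _ (law X z (G `&` ([set w | s%:E < zeta w] `&`
    [set w | E (Defs.shift X s w)])))).
  apply: le_measure_ae; first exact: measurableI.
    by apply: measurableI => //; exact: markov_measurable.
  apply: filterS2 (lifetime_infinite X_rec Iz) (af_below_shift X_rec A_pcaf c Iz s0).
  by move=> w zw Es [Gw Ew]; split => //; split; [rewrite /= zw ltry|exact: Es].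
rewrite markov//; apply: ge0_le_integral_ae => [//|w _//|].
apply: aeW => w [Gw /=] /(live_iff _ _ s0) Iw; split => //; exact: v2_ge.
Qed.

(* From here on A is gone, and time can be counted from T. *)
Let translate_window :
  \int[lam]_s \int[law X z]_w upper_window (s, w) =
  \int[lam]_s \int[law X z]_w upper_shifted (s, w).
Proof.
transitivity (\int[law X z]_w \int[lam]_s upper_window (s, w)).
  exact: (fubini_tonelli upper_window upper_window_measurable upper_window_ge0).
transitivity (\int[law X z]_w \int[lam]_s upper_shifted (s, w)); last first.
  by symmetry; exact: (fubini_tonelli upper_shifted upper_shifted_measurable upper_shifted_ge0).
apply: (ge0_ae_eq_integral measurableT (measurable_fun_fubini_tonelli_G upper_window upper_window_measurable upper_window_ge0)
  (measurable_fun_fubini_tonelli_G upper_shifted upper_shifted_measurable upper_shifted_ge0)).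
- by move=> w _; exact: integral_ge0.
- by move=> w _; exact: integral_ge0.
apply: filterS (hit_finite X_rec Iz Iy) => w Tw _.
transitivity (\int[lam]_s upper_window ((s + fine (T w))%R, w)).
  symmetry; apply: (@lebesgue_translation _ _ (fun s => upper_window (s, w))) => [|t].
    exact: (measurableT_comp upper_window_measurable (pair2_measurable w)).
  exact: upper_window_ge0.
apply: eq_integral => s _; rewrite /upper_window /upper_shifted /patch.
rewrite (_ : ((s + fine (T w))%R, w) \in window = ((s, w) \in fresh)) //.
by apply/idP/idP; rewrite !in_setE windowE// /fresh/= lerDr addrC ltrD2l.
Qed.

Let strong_markov_at_hit :
  \int[lam]_s \int[law X z]_w upper_shifted (s, w) = \int[lam]_s \int[law X y]_w upper_fresh (s, w).
Proof.
apply: eq_integral => s _.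
have [s0|s0] := boolP (0 <= s < h)%R; last first.
  have nS w : ((s, w) \in fresh) = false by apply: memNset; exact/negP.
  transitivity (0 : \bar R); last symmetry.
    by apply: integral0_eq => w _; rewrite /upper_shifted /patch nS.
  by apply: integral0_eq => w _; rewrite /upper_fresh /patch nS.
transitivity (\int[law X y]_w v2 (path_at X (s, w))); last first.
  by apply: eq_integral => w _; rewrite /upper_fresh /patch mem_set.
have s0' : (0 <= s)%R by case/andP: s0.
rewrite -[RHS](path_after_hit X_rec Iz Iy s0' mv2 v2_ge0).
by apply: eq_integral => w _; rewrite /upper_shifted /patch mem_set.
Qed.

Hypothesis v12 : exists2 N, measurable N /\ (lam \x law X y) (path_at X @^-1` N `&` fresh) = 0 &
  forall x, ~ N x -> v1 x = v2 x.

(* v1 and v2 may be exchanged under the integral, by the choice of N. *)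
Let upper_to_lower :
  \int[lam]_s \int[law X y]_w upper_fresh (s, w) = \int[lam]_s \int[law X y]_w lower_fresh (s, w).
Proof.
transitivity (\int[lam \x law X y]_p upper_fresh p).
  by symmetry; exact: (fubini_tonelli1 upper_fresh upper_fresh_measurable upper_fresh_ge0).
transitivity (\int[lam \x law X y]_p lower_fresh p); last first.
  exact: (fubini_tonelli1 lower_fresh lower_fresh_measurable lower_fresh_ge0).
apply: (ge0_ae_eq_integral measurableT upper_fresh_measurable lower_fresh_measurable
  (fun p _ => upper_fresh_ge0 p) (fun p _ => lower_fresh_ge0 p)).
have [N [mN N0] v12N] := v12.
have mN' : measurable (path_at X @^-1` N `&` fresh).
  apply: measurableI; last exact: fresh_measurable.
  by rewrite -[Y in measurable Y]setTI; exact: (path_at_measurable X measurableT mN).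
exists (path_at X @^-1` N `&` fresh); split; [exact: mN'|exact: N0|].
move=> p /= /not_implyP[_]; rewrite /upper_fresh /lower_fresh /patch.
case: ifPn => [/set_mem Sp ne|_ ne]; last by case: ne.
split; last exact: Sp.
by apply: contrapT => nN; apply: ne => /=; rewrite v12N.
Qed.

Lemma window_comparison : law X z E <= law X y (af_below_after A h c).
Proof.
suff : h%:E * law X z E <= h%:E * law X y (af_below_after A h c).
  by rewrite lee_pmul2l// lte_fin.
apply: le_trans occupation_of_window _; apply: le_trans markov_in_window _.
rewrite translate_window strong_markov_at_hit upper_to_lower; exact: lower_markov.
Qed.

End with_upper_bound.

(** The bounds v1 and v2 of the probability v_c are chosen for the occupation
measure of X during [0, h[ under [law X y]. *)
Lemma af_below_le_after : law X z E <= law X y (af_below_after A h c).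
Proof.
have fresh_lty : (lam \x law X y) fresh < +oo.
  rewrite (_ : fresh = `[0%R, h[%classic `*` setT); last first.
    by apply/seteqP; split=> -[s w] /=; rewrite in_itv//= => -[].
  rewrite product_measure1E; [|exact: measurable_itv|exact: measurableT].
  apply: le_lt_trans (ltry h).
  rewrite -[leRHS]mule1 -(probability_setT (law X y)).
  have e : lam `[0%R, h[%classic <= h%:E by rewrite lam_itv.
  exact: (lee_pmul (measure_ge0 _ _) (measure_ge0 _ _) e (lexx _)).
have [nu nuE] := restricted_image_measure fresh_measurable fresh_lty (path_at_measurable X).
have uE : umeasurable_fun I (fun x => law X x E) by exact: law_umeasurable.
have [//|v1 [v2 [mv1 mv2 v0 v12 [N [mN nuN] v12N]]]] := umeasurable_sandwich nu uE.
apply: (@window_comparison v1 v2) => //.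
- by move=> x; case: (v0 x).
- by move=> x; case: (v0 x).
- by move=> x /v12/andP[].
- by move=> x /v12/andP[].
by exists N => //; split => //; rewrite -nuE.
Qed.

End comparison.

Lemma af_below_const (R : realType) (l r : \bar R) d (Om : measurableType d)
    (X : diffusion l r Om) (A : R -> Om -> \bar R) (z y : \bar R) (c : R) :
  recurrent X (fun x => law X x) -> pcaf X A ->
  `]l, r[%classic z -> `]l, r[%classic y ->
  law X z (af_below A c) = law X y (af_below A c).
Proof.
move=> rX pA; suff le u v : `]l, r[%classic u -> `]l, r[%classic v ->
    law X u (af_below A c) <= law X v (af_below A c).
  by move=> Iz Iy; apply/eqP; rewrite eq_le !le.
move=> Iu Iv; apply: (af_below_limit rX pA Iv) => h h0.
exact: af_below_le_after.
Qed.

(** * The total mass of A is infinite *)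

Section af_infinite.
Context {R : realType} {l r : \bar R} {d : measure_display}.
Context {Om : measurableType d} (X : diffusion l r Om).
Notation I := (`]l, r[%classic : set (\bar R)).
Notation zeta := (lifetime l r X).
Hypothesis X_rec : recurrent X (fun x => law X x).
Variable A : R -> Om -> \bar R.
Hypothesis A_pcaf : pcaf X A.

Lemma af_gt_measurable (e : \bar R) t : (0 <= t)%R -> measurable [set w | e < A t w].
Proof.
move=> t0; rewrite -[Y in measurable Y]setTI.
by apply: emeasurable_fun_o_infty => //; exact: (af_measurable A_pcaf).
Qed.

Lemma stieltjes_null (a : R -> \bar R) t : (forall u : R, (0 <= u)%R -> a u = 0) ->
  (0 <= t)%R -> stieltjes a +oo `]0%R, t]%classic = 0.
Proof.
move=> a0 t0; rewrite /stieltjes; case: pselect => // nuP.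
have [+ _] := projT2 (cid nuP).
by move=> /(_ 0%R t); rewrite lexx t0 ltry !a0// sube0; apply.
Qed.

(** If A vanished under every law, all integrals in the definition of its Revuz
measure would be 0. *)
Lemma af_charges (m muA : {measure set (\bar R) -> \bar R}) :
  revuz X m A muA -> 0 < muA I ->
  exists y t e, [/\ I y, (0 <= t)%R, (0 < e)%R & 0 < law X y [set w | e%:E < A t w]].
Proof.
move=> /(_ (cst 1)) rev mu0; apply: contrapT => none.
have {}none y t e : I y -> (0 <= t)%R -> (0 < e)%R ->
    law X y [set w | e%:E < A t w] = 0.
  move=> Iy t0 e0; apply/eqP; rewrite eq_le measure_ge0 andbT leNgt.
  by apply/negP => h; apply: none; exists y, t, e.
have A0 y : I y -> {ae law X y, forall w, forall u : R, (0 <= u)%R -> A u w = 0}.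
  move=> Iy.
  have : {ae law X y, forall w, forall n k : nat, A n%:R w <= k.+1%:R^-1%:E}.
    apply: ae_foralln => n; apply: ae_foralln => k.
    exists [set w | k.+1%:R^-1%:E < A n%:R w]; split.
    - exact: af_gt_measurable.
    - by apply: none => //; rewrite invr_gt0.
    - by move=> w /= /negP; rewrite -ltNge.
  apply: filterS2 (af_regular X_rec A_pcaf Iy) => w [Am _ _] Ale u u0.
  apply/eqP; rewrite eq_le (af_ge0 A_pcaf)// andbT.
  apply/lee_addgt0Pr => e e0; rewrite add0e.
  have e1 : ((Num.truncn e^-1).+1%:R^-1 <= e)%R.
    rewrite invf_ple ?posrE// ltW//; exact: truncnS_gt.
  apply: (@le_trans _ _ (A (Num.truncn u).+1%:R w)).
    by apply: Am; rewrite u0 ltW// truncnS_gt.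
  by apply: le_trans (Ale _ (Num.truncn e^-1)) _; rewrite lee_fin.
have /rev : measurable_fun I (cst 1 : \bar R -> \bar R) by exact: measurable_cst.
move=> /(_ (fun x _ => lee01)).
rewrite (_ : (fun t : R => _) = cst 0) => [h|].
  have E := cvg_unique (@ereal_hausdorff R) (cvg_cst _) h.
  move: mu0; rewrite -[muA I]mul1e -integral_cst//; last exact: emeasurable_itv.
  by rewrite /cst/= -E ltxx.
apply/funext => t /=; rewrite [X in _ * X]integral0_eq ?mule0// => x Ix.
apply: integral_eq0_ae; last by move=> w _; exact: integral_ge0.
apply: filterS2 (lifetime_infinite X_rec Ix) (A0 _ Ix) => w zw Aw _.
rewrite zw (_ : [set u | _] = `]0%R, t]%classic); last first.
  by apply/seteqP; split=> u /=; rewrite in_itv/= ltry; [case|].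
rewrite integral_cst ?mul1e//.
have [t0|t0] := leP 0%R t; first exact: stieltjes_null.
by rewrite set_itv_ge ?measure0// bnd_simp -leNgt ltW.
Qed.

(** By induction on n, for all c < n * e. *)
Lemma af_below_null (m muA : {measure set (\bar R) -> \bar R}) x c :
  revuz X m A muA -> 0 < muA I -> I x -> law X x (af_below A c) = 0.
Proof.
move=> /af_charges h /h [y [t [e [Iy t0 e0 pos]]]] Ix.
suff : forall n : nat, forall c : R, (c < n%:R * e)%R ->
    forall x, I x -> law X x (af_below A c) = 0.
  move=> /(_ (Num.truncn (c / e)).+1 c); apply => //.
  by rewrite -ltr_pdivrMr// truncnS_gt.
elim=> [|n IH] {}c cn {x Ix} x Ix.
  rewrite mul0r in cn; rewrite (_ : af_below A c = set0) ?measure0//.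
  apply/seteqP; split=> w // /(_ 0%N); rewrite leNgt => /negP; apply.
  by apply: lt_le_trans (af_ge0 A_pcaf _ (lexx 0%R)); rewrite lte_fin.
rewrite (af_below_const c X_rec A_pcaf Ix Iy).
pose G := [set w | A t w <= e%:E].
have FG : filt X t G.
  rewrite (_ : G = A t @^-1` `]-oo, e%:E]%classic).
    by apply: (af_filt A_pcaf) => //; exact: emeasurable_itv.
  by apply/seteqP; split=> w /=; rewrite in_itv/=.
have mG := filt_measurable t0 FG.
have mE c' := af_below_measurable A_pcaf c'.
have fT : filt X t setT by rewrite -filtE.
pose live := [set w | t%:E < zeta w].
pose S c' := live `&` [set w | af_below A c' (Defs.shift X t w)].
have mS c' : measurable (S c') by exact: markov_measurable.
have mlive : measurable live by exact: live_measurable.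
have : law X y (af_below A c) <= law X y (G `&` S c) + law X y (S (c - e)%R).
  apply: le_trans (measureU2 _ _ _) => //; last exact: measurableI.
  apply: le_measure_ae => //; first by apply: measurableU => //; exact: measurableI.
  apply: filterS3 (lifetime_infinite X_rec Iy) (af_below_shift X_rec A_pcaf c Iy t0)
    (af_below_split X_rec A_pcaf e c Iy t0) => w zw h1 h2 Ew.
  have lw : live w by rewrite /live/= zw ltry.
  have [AG|AG] := leP (A t w) e%:E; first by left; split => //; split => //; exact: h1.
  by right; split => //; exact: h2.
have -> : law X y (S (c - e)%R) = 0.
  have := markov t0 (mE (c - e)%R) Iy fT; rewrite !setTI => ->.
  apply: integral0_eq => w /(live_iff X _ t0); apply: IH.
  by rewrite ltrBlDr -[X in (_ < _ + X)%R]mul1r -mulrDl natr1.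
rewrite adde0 /S markov//.
have -> : \int[law X y]_(w in G `&` live) law X (X t w) (af_below A c) =
    \int[law X y]_(w in G `&` live) cst (law X y (af_below A c)) w.
  apply: eq_integral => w /set_mem[_ /(live_iff X _ t0) Iw].
  exact: af_below_const.
rewrite integral_cst; last exact: measurableI.
move=> le_q; have {}le_q : law X y (af_below A c) <=
  law X y (af_below A c) * law X y (G `&` live) := le_q.
have GP : law X y (G `&` live) <= 1 - law X y [set w | e%:E < A t w].
  have mgt := af_gt_measurable e%:E t0.
  rewrite -probability_setC//; apply: le_measure; rewrite ?inE//.
  - exact: measurableI.
  - exact: measurableC.
  - by move=> w [Gw _] /=; rewrite ltNge => /negP.
have fin B : law X y B \is a fin_num -> exists b : R, law X y B = b%:E.
  by move=> /fineK <-; eexists.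
have [q qE] : exists q : R, law X y (af_below A c) = q%:E by apply: fin; exact: fin_num_measure.
have [p pE] : exists p : R, law X y [set w | e%:E < A t w] = p%:E.
  by apply: fin; apply: fin_num_measure; exact: af_gt_measurable.
have [k kE] : exists k : R, law X y (G `&` live) = k%:E.
  by apply: fin; apply: fin_num_measure; exact: measurableI.
have q0 : 0 <= law X y (af_below A c) by exact: measure_ge0.
move: GP pos q0 le_q; rewrite qE pE kE -!EFinM -EFinB !lee_fin lte_fin => kp p0 q0 qk.
by congr (_%:E); nra.
Qed.

End af_infinite.

Section discount.
Context {R : realType} {l r : \bar R} {d : measure_display}.
Context {Om : measurableType d} (X : diffusion l r Om).
Notation I := (`]l, r[%classic : set (\bar R)).
Notation zeta := (lifetime l r X).
Hypothesis X_rec : recurrent X (fun x => law X x).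
Variable A : R -> Om -> \bar R.
Hypothesis A_pcaf : pcaf X A.

Section infinite.
Variables m muA : {measure set (\bar R) -> \bar R}.
Hypothesis A_revuz : revuz X m A muA.
Hypothesis muA_gt0 : 0 < muA I.

Lemma af_infinite x : I x -> {ae law X x, forall w, A t w @[t --> +oo%R] --> +oo}.
Proof.
move=> Ix.
have un : {ae law X x, forall w, forall n : nat, ~ af_below A n%:R w}.
  apply: ae_foralln => n; exists (af_below A n%:R); split.
  - exact: (af_below_measurable A_pcaf).
  - exact: (@af_below_null _ _ _ _ _ X X_rec A A_pcaf m muA x n%:R A_revuz muA_gt0 Ix).
  - by move=> w /=; exact: contrapT.
apply: filterS2 (af_regular X_rec A_pcaf Ix) un => w [Am _ _] nE.
apply/cvgeyPge => M; have /existsNP[k /negP] := nE (Num.truncn M).+1.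
rewrite -ltNge => kA; exists k%:R; split; first exact: num_real.
move=> t kt; apply: (@le_trans _ _ (Num.truncn M).+1%:R%:E).
  by rewrite lee_fin ltW// truncnS_gt.
by apply: le_trans (ltW kA) _; apply: Am; rewrite ler0n ltW.
Qed.

Lemma af_grows x (c : R) (e : \bar R) : I x -> 0 < e ->
  exists k : nat, law X x [set w | A k%:R w <= c%:E] < e.
Proof.
move=> Ix e0; apply: contrapT => nk.
have : e <= law X x set0.
  apply: (@le_limsup_probability _ _ _ _ _ (fun k => [set w | A k%:R w <= c%:E])) => //.
  - move=> k; rewrite -[Y in measurable Y]setTI.
    by apply: emeasurable_fun_infty_c => //; exact: (af_measurable A_pcaf).
  - by move=> k; rewrite leNgt; apply/negP => h; apply: nk; exists k.
  apply: filterS (af_infinite Ix) => w /cvgeyPge/(_ (c + 1)%R)[M [_ hM]] io.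
  have [n Mn /=] := io (Num.truncn M).+1.
  rewrite leNgt => /negP; apply; apply: (@lt_le_trans _ _ (c + 1)%R%:E).
    by rewrite lte_fin ltrDl.
  by apply: hM; apply: lt_le_trans (truncnS_gt _) _; rewrite ler_nat.
by rewrite measure0 leNgt e0.
Qed.

End infinite.

(** Read T as a random time: the expectation of exp(-A_T). *)
Definition discount x (T : Om -> \bar R) : \bar R :=
  \int[law X x]_(w in [set w | T w < zeta w]) expeR (- A (fine (T w)) w).

Lemma discount_ge0 x T : 0 <= discount x T.
Proof. by apply: integral_ge0 => w _; exact: expeR_ge0. Qed.

Lemma live_fine T w : 0 <= T w -> T w < zeta w -> T w = (fine (T w))%:E.
Proof.
by move=> T0 Tz; rewrite fineK// ge0_fin_numE// (lt_le_trans Tz) ?leey.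
Qed.

Lemma exp_af_le1 t w : (0 <= t)%R -> expeR (- A t w) <= 1.
Proof. by move=> t0; rewrite -expeR0 lee_expeR oppe_le0 (af_ge0 A_pcaf). Qed.

Lemma discount_le1 x T : (forall w, 0 <= T w) -> discount x T <= 1.
Proof.
move=> T0; apply: (@le_trans _ _ (\int[law X x]_w cst 1 w)); last first.
  by rewrite integral_cst// mul1e; exact: (probability_le1 _ measurableT).
apply: ge0_le_integral_ae => //; first by move=> w _; exact: expeR_ge0.
by apply: aeW => w _; split => //; apply: exp_af_le1; exact: fine_ge0.
Qed.

Lemma discountS x S T : I x -> (forall w, 0 <= S w) -> (forall w, S w <= T w) ->
  discount x T <= discount x S.
Proof.
move=> Ix S0 ST; apply: ge0_le_integral_ae.
- by move=> w _; exact: expeR_ge0.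
- by move=> w _; exact: expeR_ge0.
apply: filterS (af_regular X_rec A_pcaf Ix) => w [Am _ _] Tz.
have Sz : S w < zeta w by exact: le_lt_trans Tz.
split=> //; rewrite lee_expeR leeN2; apply: Am; rewrite fine_ge0//=.
by rewrite -lee_fin -live_fine// -live_fine// (le_trans (S0 w)).
Qed.

(** Either T < k, or A_T >= A_k, which exceeds c unless A_k <= c. *)
Lemma discount_le x T (k c : R) : I x -> optional X T -> (0 <= k)%R ->
  discount x T <= law X x [set w | T w < k%:E] +
    law X x [set w | A k w <= c%:E] + (expR (- c))%:E.
Proof.
move=> Ix oT k0; have [T0 _] := oT.
have mB := optional_measurable k oT.
have mC : measurable [set w | A k w <= c%:E].
  rewrite -[Y in measurable Y]setTI.
  by apply: emeasurable_fun_infty_c => //; exact: (af_measurable A_pcaf).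
set B := [set w | T w < _] in mB *; set C := [set w | A k w <= _] in mC *.
apply: (@le_trans _ _ (\int[law X x]_w
    ((\1_B w)%:E + (\1_C w)%:E + cst (expR (- c))%:E w))); last first.
  have ind0 (D : set Om) w : 0 <= (\1_D w : R)%:E by rewrite lee_fin.
  have mB' : measurable_fun setT (fun w => (\1_B w : R)%:E).
    by apply/measurable_EFinP; exact: measurable_indic.
  have mC' : measurable_fun setT (fun w => (\1_C w : R)%:E).
    by apply/measurable_EFinP; exact: measurable_indic.
  have ind2 w : [set: Om] w -> 0 <= (\1_B w : R)%:E + (\1_C w)%:E by rewrite adde_ge0.
  have exp0 w : [set: Om] w -> 0 <= cst (expR (- c))%:E w by rewrite lee_fin expR_ge0.
  rewrite (ge0_integralD _ measurableT ind2 (emeasurable_funD mB' mC') exp0)//.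
  rewrite (ge0_integralD _ measurableT (fun w _ => ind0 B w) mB' (fun w _ => ind0 C w) mC').
  rewrite !integral_indic// !setIT integral_cst//.
  rewrite leeD// -[leRHS]mule1 lee_wpmul2l ?lee_fin ?expR_ge0//.
  exact: (probability_le1 _ measurableT).
apply: ge0_le_integral_ae.
- by move=> w _; exact: expeR_ge0.
- by move=> w _; rewrite !adde_ge0// lee_fin// expR_ge0.
apply: filterS (af_regular X_rec A_pcaf Ix) => w [Am _ _] Tz; split => //.
have le1 : expeR (- A (fine (T w)) w) <= 1 by apply: exp_af_le1; exact: fine_ge0.
rewrite !indicE; have [wB|wB] := boolP (w \in B).
  apply: le_trans le1 _; rewrite -addeA leeDl// adde_ge0// lee_fin// expR_ge0.
have [wC|wC] := boolP (w \in C).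
  by rewrite add0e; apply: le_trans le1 _; rewrite leeDl// lee_fin expR_ge0.
rewrite !add0e -[leRHS]/(expeR (- c)%:E) lee_expeR EFinN leeN2.
have kT : k%:E <= T w by rewrite leNgt; apply/negP => h; move/negP: wB; apply; exact/mem_set.
have cA : c%:E <= A k w.
  by rewrite leNgt; apply/negP => h; move/negP: wC; apply; apply/mem_set; exact: ltW.
apply: le_trans cA _; apply: Am; rewrite k0/= -lee_fin -live_fine//.
Qed.

(** First c, then k and finally n are chosen large in [discount_le]. *)
Lemma discount_small m muA x (T : nat -> Om -> \bar R) :
  revuz X m A muA -> 0 < muA I -> I x -> (forall n, optional X (T n)) ->
  (forall t : R, forall k, 0 < k -> exists n, law X x [set w | T n w < t%:E] < k) ->
  forall e : R, (0 < e)%R -> exists n, discount x (T n) < e%:E.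
Proof.
move=> A_revuz muA_gt0 Ix oT late e e0.
have [c ce] : exists c, (expR (- c) < e / 3 :> R)%R.
  exists (1 - ln (e / 3))%R; rewrite opprB -[ltRHS]lnK ?posrE ?divr_gt0//.
  by rewrite ltr_expR ltrBlDr ltrDl.
have e3 : 0 < (e / 3)%:E by rewrite lte_fin divr_gt0.
have [k hk] := af_grows A_revuz muA_gt0 c Ix e3.
have [n hn] := late k%:R _ e3.
exists n; apply: le_lt_trans (@discount_le x (T n) k%:R c Ix (oT n) (ler0n _ _)) _.
rewrite (_ : e = (e / 3 + e / 3) + e / 3)%R; last by lra.
by rewrite !EFinD lteD// lteD.
Qed.

Lemma discount_gt0 x T : I x -> optional X T ->
  {ae law X x, forall w, T w < +oo} -> 0 < discount x T.
Proof.
move=> Ix oT Too; rewrite lt_neqAle discount_ge0 andbT; apply/negP => /eqP T0.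
have [T_ge0 _] := oT.
pose B (k n : nat) := [set w | T w < k%:R%:E] `&` [set w | A k%:R w <= n%:R%:E].
have mB k n : measurable (B k n).
  apply: measurableI; first exact: (optional_measurable k%:R oT).
  rewrite -[Y in measurable Y]setTI.
  by apply: emeasurable_fun_infty_c => //; exact: (af_measurable A_pcaf).
have B0 k n : law X x (B k n) = 0.
  apply/eqP; rewrite eq_le measure_ge0 andbT.
  suff : (expR (- n%:R))%:E * law X x (B k n) <= (expR (- n%:R))%:E * 0.
    by rewrite lee_pmul2l// lte_fin expR_gt0.
  rewrite mule0 [leRHS]T0 -integral_cst//; apply: ge0_le_integral_ae.
  - by move=> w _; rewrite lee_fin expR_ge0.
  - by move=> w _; exact: expeR_ge0.
  apply: filterS2 (lifetime_infinite X_rec Ix) (af_regular X_rec A_pcaf Ix).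
  move=> w zw [Am _ _] [Tk Ak]; have Tz : T w < zeta w.
    by rewrite zw (lt_trans Tk)// ltry.
  split => //; rewrite -[leLHS]/(expeR (- n%:R)%:E) lee_expeR EFinN leeN2.
  apply: le_trans Ak; apply: Am; rewrite fine_ge0//=.
  by rewrite -lee_fin -live_fine// ltW.
have nB : {ae law X x, forall w, forall k n, ~ B k n w}.
  apply: ae_foralln => k; apply: ae_foralln => n.
  by exists (B k n); split; [exact: mB|exact: B0|move=> w /=; exact: contrapT].
have : law X x setT <= law X x set0.
  apply: le_measure_ae => //.
  apply: filterS3 Too (af_regular X_rec A_pcaf Ix) nB => w Tw [_ Af _] hB _.
  pose k := (Num.truncn (fine (T w))).+1.
  have AE := fineK (Af k%:R (ler0n _ _)).
  apply: (hB k (Num.truncn (fine (A k%:R w))).+1); split => /=.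
    by rewrite -(fineK (x := T w)) ?ge0_fin_numE// lte_fin truncnS_gt.
  by rewrite -AE lee_fin ltW// truncnS_gt.
by rewrite probability_setT measure0 leNgt lte01.
Qed.

End discount.

(** * The transformed laws *)

Section transformed.
Context {R : realType} {l r : \bar R} {d : measure_display}.
Context {Om : measurableType d} (X : diffusion l r Om).
Notation I := (`]l, r[%classic : set (\bar R)).
Notation zeta := (lifetime l r X).
Notation "'mQ'" := (@measurable _ (path_algebra X)).
Hypothesis X_rec : recurrent X (fun x => law X x).
Variables (m muA : {measure set (\bar R) -> \bar R}) (A : R -> Om -> \bar R).
Hypotheses (A_pcaf : pcaf X A) (A_revuz : revuz X m A muA) (muA_gt0 : 0 < muA I).
Variables (g : \bar R -> R) (Q : \bar R -> probability (path_algebra X) R).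
Hypotheses (g_ge0 : forall x, I x -> (0 <= g x)%R)
  (g_bounded : forall a b, I a -> I b -> exists K, forall x, a <= x <= b -> (g x <= K)%R)
  (gQ : path_transformation g A Q).

Lemma pathQ_measurable t B : (0 <= t)%R -> measurable B -> mQ (X t @^-1` B).
Proof.
move=> t0 mB; rewrite -[Y in mQ Y]setTI.
by apply: (@observable_measurable _ _ _ X `[0%R, +oo[%classic) => //=; rewrite in_itv/= t0.
Qed.

Lemma Q_start x : I x -> {ae Q x, forall w, X 0%R w = x}.
Proof.
move=> Ix; apply: (@probability1_ae _ (path_algebra X) _ (Q x) [set w | X 0%R w = x]).
  by apply: (@pathQ_measurable 0%R [set x]) => //; exact: emeasurable_set1.
by case: gQ => _ _ + _; apply.
Qed.

Lemma optionalQ_measurable T (t : R) : optional X T -> mQ [set w | T w < t%:E].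
Proof.
move=> [T0 mT]; have [t0|t0] := ltP 0%R t.
  apply: observables_sub (mT t t0) => u /=; rewrite !in_itv/= => /andP[-> _]//.
rewrite [Y in mQ Y](_ : _ = set0); first exact: measurable0.
by apply/seteqP; split=> w //=; rewrite ltNge (le_trans _ (T0 w)).
Qed.

Lemma optionalQ_lty T : optional X T -> mQ [set w | T w < +oo].
Proof.
move=> oT; rewrite lty_bigcup; last by case: oT.
by apply: (@bigcupT_measurable _ (path_algebra X)) => n; exact: optionalQ_measurable.
Qed.

Lemma natural_stopped t C : (0 <= t)%R -> natural_filtration X t C ->
  stopped_sigma (natural_filtration X) (cst t%:E) C.
Proof.
move=> t0 FC; split.
  by apply: sub_sigma_algebra; exists t => //=; rewrite in_itv/= t0.
move=> s s0; rewrite /cst lee_fin; have [ts|ts] := boolP (t <= s)%R.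
  by rewrite set_true// setIT => u /= su; apply: FC => /=; exact: le_lt_trans su.
by rewrite set_false// setI0 => u _; exact: sigma_algebra0.
Qed.

Lemma natural_setT T : stopping_time (natural_filtration X) T ->
  stopped_sigma (natural_filtration X) T setT.
Proof.
move=> [_ mT]; split; last by move=> t t0; rewrite setTI; exact: mT.
exact: (@measurableT _ (g_sigma_algebraType _)).
Qed.

Lemma gQ_formula x T C : I x -> optional X T ->
  stopped_sigma (natural_filtration X) T C ->
  Q x (C `&` [set w | T w < zeta w]) =
  (\int[law X x]_(w in C `&` [set w | T w < zeta w])
    ((g (X (fine (T w)) w))%:E * expeR (- A (fine (T w)) w))) * ((g x)^-1)%:E.
Proof. by move=> Ix /optional_stopping oT CT; case: gQ => _ _ _; apply. Qed.

(** The transformation at time 0 gives mass 0 to Q x if g x = 0, because the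
inverse of 0 is 0. *)
Lemma g_gt0 x : I x -> (0 < g x)%R.
Proof.
move=> Ix; rewrite lt_neqAle g_ge0// andbT eq_sym; apply/negP => /eqP gx0.
have o0 : optional X (cst 0%R%:E) by exact: optional_cst.
have := gQ_formula Ix o0 (natural_setT (optional_stopping o0)).
rewrite gx0 invr0 mule0 setTI => Q0.
have live0 : [set w | cst 0 w < zeta w] = X 0%R @^-1` I.
  by apply/seteqP; split=> w /(live_iff X w (lexx 0%R)).
have : Q x setT <= Q x (X 0%R @^-1` I).
  apply: (@le_measure_ae _ _ _ (Q x)) => //.
    by apply: pathQ_measurable => //; exact: emeasurable_itv.
  by apply: (ae_imp _ (Q_start Ix)) => w /= ->.
by rewrite -live0 [leRHS]Q0 [leLHS]probability_setT leNgt lte01.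
Qed.

Lemma Q_hit x y S : I x -> I y -> optional X S ->
  Q x [set w | next_hit X S y w < +oo] =
  (g y / g x)%:E * discount X A x (next_hit X S y).
Proof.
move=> Ix Iy oS; have [S0 _] := oS.
have oT := optional_hit (diffusion_path X) oS Iy.
have hz w := hit_lt_lifetime (diffusion_path X w) (S0 w) Iy.
have -> : [set w | next_hit X S y w < +oo] = [set w | next_hit X S y w < zeta w].
  by apply/seteqP; split=> w /= Tw; [exact: (hz w).1|exact: (hz w).2].
have := gQ_formula Ix oT (natural_setT (optional_stopping oT)).
rewrite !setTI => E; apply: (etrans E).
rewrite [X in X * _](_ : _ = (g y)%:E * discount X A x (next_hit X S y)).
  by rewrite muleAC -EFinM.
rewrite -ge0_integralZl_lower; last 2 first.
- exact: g_gt0.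
- by move=> w _; exact: expeR_ge0.
apply: eq_integral => w /set_mem Tw.
by rewrite (path_at_hit (diffusion_path X w) (S0 w))//; exact/hz.
Qed.

Lemma discount_cst_small x k (e : R) : I x -> (0 < e)%R ->
  exists j, (k <= j)%N /\ discount X A x (cst j%:R%:E) < e%:E.
Proof.
move=> Ix e0.
have [|t c c0|n hn] := @discount_small _ _ _ _ _ X X_rec A A_pcaf m muA x
  (fun n => cst (n + k)%:R%:E) A_revuz muA_gt0 Ix _ _ e e0.
- by move=> n; exact: optional_cst.
- exists (Num.truncn t).+1; rewrite (_ : [set w | _] = set0) ?measure0//.
  apply/seteqP; split=> w //=; rewrite lte_fin ltNge => /negP; apply.
  by rewrite ltW// (lt_le_trans (truncnS_gt _))// ler_nat leq_addr.
by exists (n + k)%N; rewrite leq_addl.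
Qed.

(** The first visit of y after time k has a small discount for large k. *)
Lemma Q_leave x y : I x -> I y ->
  {ae Q x, forall w, exists k : nat, forall t, (k%:R < t)%R -> X t w <> y}.
Proof.
move=> Ix Iy; pose V (k : nat) := [set w | next_hit X (cst k%:R%:E) y w < +oo].
have mV k : mQ (V k).
  by apply: optionalQ_lty; apply: (optional_hit (diffusion_path X)) => //; exact: optional_cst.
exists (\bigcap_k V k); split.
- exact: (@bigcapT_measurable _ (path_algebra X)).
- apply/eqP; rewrite eq_le measure_ge0 andbT; apply/lee_addgt0Pr => e e0; rewrite add0e.
  pose c := (g y / g x)%R.
  have c0 : (0 < c)%R by rewrite divr_gt0// g_gt0.
  have [k [_ hk]] := discount_cst_small 0 Ix (divr_gt0 e0 c0).
  apply: (@le_trans _ _ (Q x (V k))).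
    apply: le_measure; rewrite ?inE//; first exact: (@bigcapT_measurable _ (path_algebra X)).
    by move=> w; apply.
  rewrite [leLHS]Q_hit//; last exact: optional_cst.
  rewrite -/c -lee_pdivlMl// muleC -EFinM; apply: ltW.
  apply: le_lt_trans hk; apply: (discountS X_rec A_pcaf) => // w.
    by rewrite lee_fin.
  exact: le_next_time.
- move=> w /= nk k _; rewrite /V /=; apply: contrapT => nV; apply: nk; exists k => t kt Xt.
  by apply: nV; apply/next_time_lt; exists t; rewrite lte_fin ltry.
Qed.

(** The transformation at a late deterministic time, with g bounded on [a, b]. *)
Lemma Q_wander x a b k : I x -> I a -> I b ->
  {ae Q x, forall w, exists j, (k <= j)%N /\ ~ (a <= X j%:R w <= b)}.
Proof.
move=> Ix Ia Ib; pose W j := X j%:R @^-1` `[a, b]%classic.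
have mW j : mQ (W j) by apply: pathQ_measurable => //; exact: emeasurable_itv.
have WE j w : W j w <-> a <= X j%:R w <= b by rewrite /W/= in_itv.
exists (\bigcap_n W (n + k)%N); split.
- by apply: (@bigcapT_measurable _ (path_algebra X)) => n; exact: mW.
- apply/eqP; rewrite eq_le measure_ge0 andbT; apply/lee_addgt0Pr => e e0; rewrite add0e.
  have [K0 hK0] := g_bounded Ia Ib; pose K := Num.max K0 1%R.
  have K_gt0 : (0 < K)%R by rewrite lt_max ltr01 orbT.
  have gK y : a <= y <= b -> (g y <= K)%R by move=> /hK0 h; rewrite le_max h.
  have c0 : (0 < K / g x)%R by rewrite divr_gt0// g_gt0.
  have [j [kj hj]] := discount_cst_small k Ix (divr_gt0 e0 c0).
  have Wlive w : W j w -> j%:R%:E < zeta w.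
    move=> /WE /andP[aX Xb]; apply/live_iff => //; move: Ia Ib; rewrite /= !in_itv/=.
    by move=> /andP[la _] /andP[_ br]; rewrite (lt_le_trans la)// (le_lt_trans Xb).
  apply: (@le_trans _ _ (Q x (W j `&` [set w | cst j%:R%:E w < zeta w]))).
    rewrite (_ : W j `&` _ = W j); last by apply/setIidPl => w /Wlive.
    apply: le_measure; rewrite ?inE//.
      by apply: (@bigcapT_measurable _ (path_algebra X)) => n; exact: mW.
    by move=> w /(_ (j - k)%N Logic.I); rewrite subnK.
  rewrite [leLHS](gQ_formula Ix); last 2 first.
  - exact: optional_cst.
  - apply: natural_stopped => // u /= ju.
    rewrite -[Y in <<s _ >> Y]setTI.
    apply: (@observable_measurable _ _ _ X `[0%R, u]%classic) => //.
      by rewrite /= in_itv/= ler0n ltW.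
    exact: emeasurable_itv.
  apply: (@le_trans _ _ (K%:E * discount X A x (cst j%:R%:E) * ((g x)^-1)%:E)).
    rewrite lee_wpmul2r ?lee_fin ?invr_ge0 ?g_ge0//.
    rewrite -ge0_integralZl_lower//; last by move=> w _; exact: expeR_ge0.
    apply: ge0_le_integral_ae.
    - move=> w [_ /(live_iff X _ (ler0n _ j))] Iw.
      by rewrite mule_ge0 ?expeR_ge0// lee_fin g_ge0.
    - by move=> w _; rewrite mule_ge0 ?expeR_ge0// lee_fin ltW.
    apply: aeW => w [/WE /gK gw live]; split => //.
    by rewrite lee_wpmul2r ?expeR_ge0// lee_fin.
  by rewrite muleAC -EFinM -lee_pdivlMl// muleC -EFinM ltW.
- move=> w /= nj n _; apply: contrapT => nW; apply: nj; exists (n + k)%N.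
  by rewrite leq_addl; split => // /WE.
Qed.

Notation limit e := [set w | X t w @[t --> +oo%R] --> (e : \bar R)].

Lemma ends_seq y : I y -> exists a b : (\bar R)^nat,
  [/\ forall n, I (a n), forall n, I (b n), a @ \oo --> l & b @ \oo --> r].
Proof.
rewrite /= in_itv/= => /andP[ly yr].
have [a aP al] := left_end_seq ly; have [b bP br] := right_end_seq yr.
exists a, b; split => // n; rewrite /= in_itv/=.
  by have /andP[-> /lt_trans->] := aP n.
by have /andP[/(lt_trans ly)-> ->] := bP n.
Qed.

Lemma Q_ends x : I x -> {ae Q x, forall w, limit l w \/ limit r w}.
Proof.
move=> Ix; have [a [b [Ia Ib al br]]] := ends_seq Ix.
have ha : {ae Q x, forall w, forall n, exists k : nat, forall t, (k%:R < t)%R -> X t w <> a n}.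
  by apply: ae_foralln => n; exact: Q_leave.
have hb : {ae Q x, forall w, forall n, exists k : nat, forall t, (k%:R < t)%R -> X t w <> b n}.
  by apply: ae_foralln => n; exact: Q_leave.
have hab : {ae Q x, forall w, forall n m k, exists j, (k <= j)%N /\ ~ (a n <= X j%:R w <= b m)}.
  by apply: ae_foralln => n; apply: ae_foralln => j; apply: ae_foralln => k; exact: Q_wander.
apply: (ae_imp2 _ ha (ae_imp2 _ hb hab)); last first.
  by move=> w h1 h2; exact: (conj h1 h2).
move=> w h1 [h2 h3]; exact: (path_dichotomy (diffusion_path X w) Ia Ib al br h1 h2 h3).
Qed.

Lemma end_bases y : I y ->
  (exists B, end_basis l r l B) /\ (exists B, end_basis l r r B).
Proof.
move=> Iy; have [a [b [Ia Ib al br]]] := ends_seq Iy; split.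
  exists (fun n => [set y | y <= a n]); apply: left_end_basis => // n.
  by have := Ia n; rewrite /= in_itv/= => /andP[].
exists (fun n => [set y | b n <= y]); apply: right_end_basis => // n.
by have := Ib n; rewrite /= in_itv/= => /andP[].
Qed.

Lemma limit_measurable e B : end_basis l r e B -> mQ (limit e).
Proof.
move=> eB; have [_ mB _ _] := eB.
rewrite [Y in mQ Y](_ : _ = \bigcap_n \bigcup_k ~` (\bigcup_q
    [set w | (k%:R <= q :> rat)%R && (X (ratr q) w \notin B n)])).
  apply: (@bigcapT_measurable _ (path_algebra X)) => n.
  apply: (@bigcupT_measurable _ (path_algebra X)) => k; apply: measurableC.
  apply: (@bigcupT_measurable_rat _ (path_algebra X)) => q.
  have [kq|_] := boolP (k%:R <= q :> rat)%R; last by rewrite set_false; exact: measurable0.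
  rewrite (_ : [set w | _] = X (ratr q) @^-1` (~` B n)).
    apply: pathQ_measurable; last exact: measurableC.
    by rewrite ler0q; exact: le_trans kq.
  by apply/seteqP; split=> w /= => [/negP h /mem_set//|h]; apply/negP => /set_mem.
have P w := path_end_cvgP (diffusion_path X w) eB.
apply/seteqP; split=> w /=.
  move=> /P h n _; have [k hk] := h n; exists k => // -[q _ /= /andP[kq /negP]].
  by apply; apply/mem_set; exact: hk.
move=> h; apply/P => n; have [k _ nk] := h n Logic.I; exists k => q kq.
apply: contrapT => nB; apply: nk; exists q => //=; rewrite kq/=.
by apply/negP => /set_mem.
Qed.

(** A path that starts at an end has lifetime 0 and exits everywhere, for lack of
times before its lifetime; the other paths exit where they converge. *)
Lemma exits_atE e :
  exits_at l r X e = ([set w | I (X 0%R w)] `&` limit e) `|` [set w | ~ I (X 0%R w)].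
Proof.
apply/seteqP; split=> w; rewrite /exits_at/=.
  have [Iw|nIw] := pselect (I (X 0%R w)); last by right.
  by move=> /(exits_atP (diffusion_path X w) _ Iw); left.
move=> [[Iw /(exits_atP (diffusion_path X w) _ Iw)]//|nIw].
have z0 : zeta w <= 0.
  by rewrite leNgt; apply/negP => /(live_iff X w (lexx 0%R)).
move=> U _; rewrite /before; apply: filterS (@filterT _ (nbhs (zeta w)) _) => u _ /=.
by rewrite in_itv/= => /andP[u0 /lt_le_trans/(_ z0)]; rewrite ltNge u0.
Qed.

(** The definition of this event involves the lifetime and a limit along all
times; its description by [exits_atE] reduces it to countably many. *)
Lemma exits_measurable e B : end_basis l r e B -> mQ (exits_at l r X e).
Proof.
move=> eB; rewrite exits_atE.
have m0 : mQ [set w | I (X 0%R w)] by apply: (@pathQ_measurable 0%R I) => //; exact: emeasurable_itv.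
apply: (@measurableU _ (path_algebra X)); last exact: (@measurableC _ (path_algebra X)).
by apply: (@measurableI _ (path_algebra X)) => //; exact: limit_measurable eB.
Qed.

Lemma exits_ae x e : I x -> {ae Q x, forall w, exits_at l r X e w <-> limit e w}.
Proof.
move=> Ix; apply: (ae_imp _ (Q_start Ix)) => w Xw; rewrite exits_atE; split.
  by move=> [[]//|]; rewrite /= Xw.
by move=> h; left; split => //=; rewrite Xw.
Qed.

Lemma late_Q x (b : (\bar R)^nat) (e : \bar R) : I x -> (forall n, I (b n)) ->
  b @ \oo --> e -> ~ I e -> forall c : R, (0 < c)%R ->
  exists n, discount X A x (hit X (b n)) < c%:E.
Proof.
move=> Ix Ib be nIe; apply: (discount_small X_rec A_pcaf A_revuz muA_gt0 Ix).
  by move=> n; exact: hit_optional.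
by move=> t k k0; exact: (late_hits X_rec Ix Ib be nIe k0 t).
Qed.

Lemma Q_hit0 x y : I x -> I y -> Q x [set w | hit X y w < +oo] =
  (g y / g x)%:E * discount X A x (hit X y).
Proof.
by move=> Ix Iy; apply: (@Q_hit x y (cst 0)) => //; exact: (@optional_cst _ _ _ _ 0%R).
Qed.

(** If X were recurrent under Q, [Q_hit0] and the bound 1 for discounts would make
g constant and all discounts of hitting times equal to 1. *)
Lemma Q_transient x : I x -> transient X (fun x => Q x).
Proof.
move=> Ix Qrec; have [a [b [Ia Ib al br]]] := ends_seq Ix.
have nIr : ~ I r by rewrite /= in_itv/= ltxx andbF.
have E y z : I y -> I z -> (g z / g y)%:E * discount X A y (hit X z) = 1.
  by move=> Iy Iz; rewrite -Q_hit0//; exact: Qrec.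
have le y z : I y -> I z -> (g y <= g z)%R.
  move=> Iy Iz; have := E y z Iy Iz => /eqP; apply: contraTT; rewrite -ltNge => zy.
  rewrite lt_eqF//; have c1 : (g z / g y < 1)%R by rewrite ltr_pdivrMr ?mul1r// g_gt0.
  apply: (@le_lt_trans _ _ (g z / g y)%:E); last by rewrite lte_fin.
  rewrite -[leRHS]mule1 lee_wpmul2l//; first by rewrite lee_fin divr_ge0// g_ge0.
  by apply: (discount_le1 A_pcaf) => w; exact: le_next_time.
have [n] := late_Q Ix Ib br nIr (ltr01 : (0 < 1 :> R)%R).
rewrite -(E x (b n))// (_ : (g (b n) / g x)%R = 1%R) ?mul1e ?ltxx//.
have -> : g (b n) = g x by apply/eqP; rewrite eq_le !le.
by rewrite divff// gt_eqF// g_gt0.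
Qed.

Definition separates (x b e : \bar R) := x < b < e \/ e < b < x.

(** To reach e from x, the path has to visit b n for every n. *)
Lemma Q_limit_null x (b : (\bar R)^nat) (e : \bar R) : I x -> (forall n, I (b n)) ->
  b @ \oo --> e -> ~ I e -> (forall n, separates x (b n) e) ->
  (forall n, (g (b n) <= g x)%R) -> mQ (limit e) -> Q x (limit e) = 0.
Proof.
move=> Ix Ib be nIe sep gb me; apply/eqP; rewrite eq_le measure_ge0 andbT.
apply/lee_addgt0Pr => c c0; rewrite add0e.
have [n hn] := late_Q Ix Ib be nIe c0.
apply: (@le_trans _ _ (Q x [set w | hit X (b n) w < +oo])).
  apply: (@le_measure_ae _ _ _ (Q x)) => //.
    by apply: optionalQ_lty; exact: hit_optional.
  apply: (ae_imp _ (Q_start Ix)) => w Xw lw /=.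
  exact: (path_crossing (diffusion_path X w) (lexx 0%R) Xw (sep n) lw).
rewrite [leLHS]Q_hit0//; apply: ltW; apply: le_lt_trans hn.
rewrite -[leRHS]mul1e lee_wpmul2r ?discount_ge0// lee_fin.
by rewrite ler_pdivrMr ?mul1r// g_gt0.
Qed.

(** Returning to x after z costs more discount than reaching z, while the factor
g at the final point drops from g z to g x. *)
Lemma Q_limit_pos x z (e e' : \bar R) : I x -> I z ->
  (forall w, (limit l w \/ limit r w) -> limit e w \/ limit e' w) ->
  separates z x e' -> (g x < g z)%R -> mQ (limit e) -> 0 < Q x (limit e).
Proof.
move=> Ix Iz ends sep gxz me; rewrite lt_neqAle measure_ge0 andbT; apply/negP => /eqP e0.
pose T := hit X z; pose S := next_hit X T x.
have oT : optional X T by exact: hit_optional.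
have oS : optional X S by exact: (optional_hit (diffusion_path X) oT Ix).
have : Q x [set w | T w < +oo] <= Q x [set w | S w < +oo].
  rewrite -[leRHS]adde0 e0.
  have mS := optionalQ_lty oS; have mT := optionalQ_lty oT.
  apply: le_trans (measureU2 _ mS me).
  apply: (@le_measure_ae _ _ _ (Q x)) => //; first exact: (@measurableU _ (path_algebra X)).
  apply: (ae_imp _ (Q_ends Ix)) => w /ends[?|he'] Tw; [by right|left].
  have T0 : 0 <= T w by exact: le_next_time.
  have TE : T w = (fine (T w))%:E by rewrite fineK// ge0_fin_numE.
  rewrite /= /S /next_hit TE.
  apply: (path_crossing (diffusion_path X w) _ _ sep he'); first exact: fine_ge0.
  exact: (path_at_hit (diffusion_path X w) (lexx 0)).
rewrite [leLHS]Q_hit0// [leRHS]Q_hit// divff ?gt_eqF ?g_gt0// mul1e leNgt => /negP; apply.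
apply: (@le_lt_trans _ _ (discount X A x T)).
  apply: (discountS X_rec A_pcaf) => // w; exact: le_next_time.
have d0 : 0 < discount X A x T by apply: (discount_gt0 X_rec A_pcaf) => //; exact: hit_finite.
have dfin : discount X A x T \is a fin_num.
  rewrite ge0_fin_numE ?ltW//; apply: le_lt_trans (ltry 1).
  by apply: (discount_le1 A_pcaf) => w; exact: le_next_time.
move: d0; rewrite -/T -(fineK dfin) lte_fin -EFinM lte_fin => d0.
by rewrite ltr_pMl// ltr_pdivlMr ?mul1r// g_gt0.
Qed.

End transformed.

(** * Growth of the fundamental solutions *)

Section monotone_measurable.
Context {R : realType} (l r : \bar R).
Notation I := (`]l, r[%classic : set (\bar R)).

(** The sublevel sets of a monotone function on an interval are intervals. *)
Lemma nondecreasing_measurable (f : \bar R -> R) :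
  (forall x y, I x -> I y -> x <= y -> (f x <= f y)%R) -> measurable_fun I f.
Proof.
move=> fm mI; apply: (measurability _ (RGenInftyO.measurableE R)) => //.
move=> _ [_ [c ->] <-].
rewrite (_ : _ `&` _ = EFin @` [set x : R | I x%:E /\ (f x%:E < c)%R]).
  apply: measurable_image_EFin; apply: is_interval_measurable.
  move=> x y [Ix fx] [Iy fy] z /andP[xz zy].
  have Iz : I z%:E.
    move: Ix Iy; rewrite /= !in_itv/= => /andP[lx _] /andP[_ yr].
    by rewrite (lt_le_trans lx) ?lee_fin// (le_lt_trans _ yr) ?lee_fin.
  by split => //; apply: le_lt_trans fy; apply: fm => //; rewrite lee_fin.
apply/seteqP; split=> x.
  move=> [Ix /=]; rewrite in_itv/= => fx; exists (fine x); rewrite (interior_fin Ix)//.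
by move=> [y [Iy fy] <-]; split => //=; rewrite in_itv.
Qed.

Lemma nonincreasing_measurable (f : \bar R -> R) :
  (forall x y, I x -> I y -> x <= y -> (f y <= f x)%R) -> measurable_fun I f.
Proof.
move=> fm; rewrite (_ : f = (fun x => - (- f x))%R); last by apply/funext => x; rewrite opprK.
apply: (measurable_funN (f := fun x => - f x)%R); apply: nondecreasing_measurable => x y Ix Iy xy.
by rewrite lerN2 fm.
Qed.

End monotone_measurable.

(** The integral equation of a fundamental solution g, with t either the scale s
or its opposite: this covers the increasing and the decreasing case.  The
kernel and the affine part are convex in t x, hence so is g; being monotone and
nonconstant, g is unbounded where t is. *)
Section convex.
Context {R : realType} (l r : \bar R).
Notation I := (`]l, r[%classic : set (\bar R)).
Variables (t g : \bar R -> R) (mu : {measure set (\bar R) -> \bar R}) (a k : R) (L : \bar R).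
Hypotheses (k0 : (0 <= k)%R) (kL : L = -oo -> k = 0%R) (g0 : forall x, I x -> (0 <= g x)%R)
  (mt : measurable_fun I t) (mg : measurable_fun I g)
  (gE : forall x, I x -> (g x)%:E = a%:E + k%:E * ((t x)%:E - L) +
      \int[mu]_(y in I) (Num.max (t x - t y) 0 * g y)%:E).

Let J x := \int[mu]_(y in I) (Num.max (t x - t y) 0 * g y)%:E.

Let J_ge0 x : 0 <= J x.
Proof.
apply: integral_ge0 => y Iy; rewrite lee_fin mulr_ge0 ?g0//.
by rewrite le_max lexx orbT.
Qed.

(* The case L = +oo is excluded: the right-hand side of gE would be -oo. *)
Let decomposition : exists L0 : R, forall x, I x ->
  J x = (g x - a - k * (t x - L0))%:E.
Proof.
exists (fine L) => x Ix; move: (gE Ix) kL; rewrite -/(J x).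
have [->|k_neq0] := eqVneq k 0%R.
  rewrite mul0e mul0r adde0 subr0; move: (J_ge0 x); case: (J x) => [j||]//= _ [->] _.
  by congr (_%:E); lra.
have k_gt0 : (0 < k)%R by rewrite lt_neqAle eq_sym k_neq0.
case: L => [L0||] /=.
- rewrite -EFinB -EFinM; move: (J_ge0 x); case: (J x) => [j||]//= _ [->] _.
  by congr (_%:E); lra.
- by rewrite (_ : (t x)%:E - +oo = -oo)// gt0_muleNy ?lte_fin// addeNy addNye.
- by move=> _ /(_ erefl) /eqP; rewrite (negbTE k_neq0).
Qed.

(** The point t x0 lies between t x1 and t z; lam is the slope ratio for which
(1 + lam) t x0 = t z + lam t x1. *)
Lemma solution_convex x1 x0 z : I x1 -> I x0 -> I z -> (t x1 < t x0)%R -> (t x0 <= t z)%R ->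
  (g x0 + (t z - t x0) / (t x0 - t x1) * (g x0 - g x1) <= g z)%R.
Proof.
move=> I1 I0 Iz t10 t0z; set lam := (_ / _)%R.
have lam0 : (0 <= lam)%R by rewrite divr_ge0// subr_ge0// ltW.
have lamE : (lam * (t x0 - t x1) = t z - t x0)%R by rewrite /lam divfK// subr_eq0 gt_eqF.
have [L0 JE] := decomposition.
have mI : measurable I by exact: emeasurable_itv.
pose K x y := (Num.max (t x - t y) 0 * g y)%:E.
have mK x : measurable_fun I (K x).
  apply/measurable_EFinP; apply: measurable_funM => //.
  by apply: measurable_maxr => //; exact: measurable_funB.
have K_ge0 x y : I y -> 0 <= K x y.
  by move=> Iy; rewrite lee_fin mulr_ge0 ?g0// le_max lexx orbT.
have : (1 + lam)%:E * J x0 <= J z + lam%:E * J x1.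
  rewrite /J -!ge0_integralZl_EFin ?addr_ge0//; [|exact: K_ge0|exact: mK|exact: K_ge0|exact: mK].
  rewrite -ge0_integralD//; [|exact: K_ge0|exact: mK| |]; last 2 first.
  - by move=> y Iy; apply: mule_ge0; [rewrite lee_fin|exact: K_ge0].
  - by apply: measurable_funeM; exact: mK.
  apply: ge0_le_integral => //.
  - by move=> y Iy; apply: mule_ge0; [rewrite lee_fin addr_ge0|exact: K_ge0].
  - by apply: measurable_funeM; exact: mK.
  - by apply: emeasurable_funD; [exact: mK|apply: measurable_funeM; exact: mK].
  move=> y Iy; rewrite -!EFinM -EFinD lee_fin !mulrA -mulrDl ler_wpM2r ?g0//.
  have [h0|h0] := leP (t x0 - t y)%R 0%R.
    have pos (u : R) : (0 <= Num.max u 0)%R by rewrite le_max lexx orbT.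
    by rewrite mulr0 addr_ge0// mulr_ge0.
  have h1 : (t x1 - t y <= Num.max (t x1 - t y) 0)%R by rewrite le_max lexx.
  have h2 : (t z - t y <= Num.max (t z - t y) 0)%R by rewrite le_max lexx.
  have h3 := ler_wpM2l lam0 h1.
  nra.
rewrite !JE// -!EFinM -EFinD lee_fin => h.
have : ((1 + lam) * g x0 <= g z + lam * g x1)%R by nra.
lra.
Qed.

Lemma solution_unbounded x1 x0 (z : nat -> \bar R) : I x1 -> I x0 ->
  (t x1 < t x0)%R -> (g x1 < g x0)%R -> (forall n, I (z n)) ->
  (forall K : R, exists n, (K < t (z n))%R) ->
  forall K : R, exists n, (K < g (z n))%R.
Proof.
move=> I1 I0 t10 g10 Iz tz K.
pose B := (t x0 + (Num.max K 0 + 1) * (t x0 - t x1) / (g x0 - g x1))%R.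
have [n hn] := tz (Num.max B (t x0)).
move: hn; rewrite gt_max => /andP[Bn tn]; exists n.
apply: lt_le_trans (solution_convex I1 I0 (Iz n) t10 (ltW tn)).
have g00 := g0 I0.
have d1 : (0 < t x0 - t x1)%R by rewrite subr_gt0.
have d2 : (0 < g x0 - g x1)%R by rewrite subr_gt0.
have : ((Num.max K 0 + 1) < (t (z n) - t x0) / (t x0 - t x1) * (g x0 - g x1))%R.
  by rewrite -ltr_pdivrMr// ltr_pdivlMr// mulrAC ltrBrDl.
have : (K <= Num.max K 0)%R by rewrite le_max lexx.
have : (0 <= Num.max K 0)%R by rewrite le_max lexx orbT.
set q := (_ / _ * _)%R; lra.
Qed.

End convex.

Section scale_at_ends.
Context {R : realType} {l r : \bar R} {d : measure_display}.
Context {Om : measurableType d} (X : diffusion l r Om).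
Notation I := (`]l, r[%classic : set (\bar R)).
Hypothesis X_rec : recurrent X (fun x => law X x).
Variable s : \bar R -> R.
Hypothesis s_scale : is_scale X s.

Let s_lt x y : I x -> I y -> x < y -> (s x < s y)%R.
Proof. by move=> Ix Iy; case: s_scale => _ + _; apply; exact/mem_set. Qed.

Let hit_lt_measurable x y : I x -> I y -> measurable [set w | hit X x w < hit X y w].
Proof.
move=> Ix Iy; rewrite -[Y in measurable Y]setTI; apply: measurable_lte => //.
  exact: (optional_fun_measurable (hit_optional X Ix)).
exact: (optional_fun_measurable (hit_optional X Iy)).
Qed.

(** If s (b n) <= K for all n, the probability of visiting b n before a would stay
above a positive constant, while the visits of b n are late and that of a
happens. *)
Lemma scale_unbounded_right x (b : (\bar R)^nat) : I x -> (forall n, x < b n < r) ->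
  b @ \oo --> r -> forall K : R, exists n, (K < s (b n))%R.
Proof.
move=> Ix xbr br K; apply: contrapT => nK.
have {}nK n : (s (b n) <= K)%R by rewrite leNgt; apply/negP => h; apply: nK; exists n.
have [lx xr] : l < x /\ x < r by move: Ix; rewrite /= in_itv/= => /andP[].
have [a' aP _] := left_end_seq lx; pose a := a' 0%N.
have [la ax] : l < a /\ a < x by have /andP[] := aP 0%N.
have Ia : I a by rewrite /= in_itv/= la (lt_trans ax).
have Ib n : I (b n).
  by have /andP[xb br'] := xbr n; rewrite /= in_itv/= br' (lt_trans lx).
have sax := s_lt Ia Ix ax.
have sxb n : (s x < s (b n))%R by apply: s_lt => //; have /andP[] := xbr n.
have k0 : 0 < ((s x - s a) / (K - s a))%:E.
  by have := sxb 0%N; have := nK 0%N => h1 h2; rewrite lte_fin divr_gt0// subr_gt0; lra.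
suff : ((s x - s a) / (K - s a))%:E <= law X x set0 by rewrite measure0 leNgt k0.
apply: (@le_limsup_probability _ _ _ _ _ (fun n => [set w | hit X (b n) w < hit X a w])) => //.
- by move=> n; exact: hit_lt_measurable.
- move=> n; have /andP[xb br'] := xbr n.
  case: s_scale => _ _ ->//; rewrite lee_fin ler_pM2l ?subr_gt0//.
  rewrite lef_pV2 ?posrE ?subr_gt0//; last by apply: lt_trans sax _.
    by rewrite lerD2r.
  by apply: lt_le_trans (nK n); apply: lt_trans sax _.
apply: filterS2 (lifetime_infinite X_rec Ix) (hit_finite X_rec Ix Ia) => w zw aw.
have nIr : ~ I r by rewrite /= in_itv/= ltxx andbF.
have [N hN] := hit_escape (diffusion_path X w) zw nIr br (fine (hit X a w)).
move=> /(_ N)[n Nn /=]; rewrite ltNge => /negP; apply.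
have aE : hit X a w = (fine (hit X a w))%:E.
  by rewrite fineK// ge0_fin_numE//; exact: le_next_time.
by rewrite aE; exact: (hN n Nn 0 (lexx 0)).
Qed.

Lemma scale_unbounded_left x (a : (\bar R)^nat) : I x -> (forall n, l < a n < x) ->
  a @ \oo --> l -> forall K : R, exists n, (K < - s (a n))%R.
Proof.
move=> Ix lax al K; apply: contrapT => nK.
have {}nK n : (- s (a n) <= K)%R by rewrite leNgt; apply/negP => h; apply: nK; exists n.
have [lx xr] : l < x /\ x < r by move: Ix; rewrite /= in_itv/= => /andP[].
have [b' bP _] := right_end_seq xr; pose b := b' 0%N.
have [xb br] : x < b /\ b < r by have /andP[] := bP 0%N.
have Ib : I b by rewrite /= in_itv/= br (lt_trans lx).
have Ia n : I (a n).
  by have /andP[la ax] := lax n; rewrite /= in_itv/= la (lt_trans ax).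
have sxb := s_lt Ix Ib xb.
have sax n : (s (a n) < s x)%R by apply: s_lt => //; have /andP[] := lax n.
have k0 : 0 < ((s b - s x) / (s b + K))%:E.
  by have := sax 0%N; have := nK 0%N => h1 h2; rewrite lte_fin divr_gt0// ?subr_gt0; lra.
suff : ((s b - s x) / (s b + K))%:E <= law X x set0 by rewrite measure0 leNgt k0.
apply: (@le_limsup_probability _ _ _ _ _ (fun n => ~` [set w | hit X b w < hit X (a n) w])) => //.
- by move=> n; apply: measurableC; exact: hit_lt_measurable.
- move=> n; have /andP[la ax] := lax n.
  rewrite probability_setC; last exact: hit_lt_measurable.
  case: s_scale => _ _ ->//; rewrite -EFinB lee_fin.
  have h1 := sax n; have h2 := nK n.
  have d1 : (0 < s b - s (a n))%R by rewrite subr_gt0 (lt_trans h1).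
  have -> : (1 - (s x - s (a n)) / (s b - s (a n)) = (s b - s x) / (s b - s (a n)))%R.
    by rewrite -[X in (X - _)%R](@divff _ (s b - s (a n))%R) ?gt_eqF// -mulrBl; congr (_ / _)%R; lra.
  rewrite ler_pM2l ?subr_gt0// lef_pV2 ?posrE//; first by lra.
  by apply: lt_le_trans d1 _; lra.
apply: filterS2 (lifetime_infinite X_rec Ix) (hit_finite X_rec Ix Ib) => w zw bw.
have nIl : ~ I l by rewrite /= in_itv/= ltxx.
have [N hN] := hit_escape (diffusion_path X w) zw nIl al (fine (hit X b w) + 1)%R.
move=> /(_ N)[n Nn /=]; apply.
have bE : hit X b w = (fine (hit X b w))%:E.
  by rewrite fineK// ge0_fin_numE//; exact: le_next_time.
rewrite bE; apply: lt_le_trans (hN n Nn 0 (lexx 0)).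
by rewrite lte_fin ltrDl.
Qed.

(** With [solution_unbounded] for t = s; x1 and x0 are two points at which psi
differs. *)
Lemma fundamental_incr_unbounded (mu : {measure set (\bar R) -> \bar R}) psi x :
  fundamental_incr l r s mu psi -> I x ->
  forall K : R, exists z, [/\ I z, x < z & (K < psi z)%R].
Proof.
move=> [p0 pm [u [v [Iu Iv puv]]] [a [k [a0 k0 kL pE]]]] Ix K.
have pmono y z : I y -> I z -> y <= z -> (psi y <= psi z)%R.
  by move=> Iy Iz; apply: pm; exact/mem_set.
have smono y z : I y -> I z -> y <= z -> (s y <= s z)%R.
  by move=> Iy Iz; rewrite le_eqVlt => /predU1P[->//|yz]; exact/ltW/s_lt.
have [x1 [x0 [I1 I0 x10 p10]]] : exists x1 x0, [/\ I x1, I x0, x1 < x0 & (psi x1 < psi x0)%R].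
  have [uv|vu|uv] := ltgtP u v; last by move: puv; rewrite uv.
    by exists u, v; split => //; rewrite lt_neqAle pmono ?ltW// andbT; exact/eqP.
  exists v, u; split => //; rewrite lt_neqAle pmono ?ltW// andbT.
  by apply/eqP => e; apply: puv.
have [lx xr] : l < x /\ x < r by move: Ix; rewrite /= in_itv/= => /andP[].
have [b xbr br] := right_end_seq xr.
have Ib n : I (b n).
  by have /andP[xb br'] := xbr n; rewrite /= in_itv/= br' (lt_trans lx).
have [n hn] := solution_unbounded k0 kL p0 (nondecreasing_measurable smono)
  (nondecreasing_measurable pmono) pE I1 I0 (s_lt I1 I0 x10) p10 Ib
  (scale_unbounded_right Ix xbr br) K.
by exists (b n); split => //; have /andP[] := xbr n.
Qed.

(** With [solution_unbounded] for t = - s, which is decreasing in x but increasing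
towards l. *)
Lemma fundamental_decr_unbounded (mu : {measure set (\bar R) -> \bar R}) phi x :
  fundamental_decr l r s mu phi -> I x ->
  forall K : R, exists z, [/\ I z, z < x & (K < phi z)%R].
Proof.
move=> [p0 pm [u [v [Iu Iv puv]]] [a [k [a0 k0 kL pE]]]] Ix K.
have pmono y z : I y -> I z -> y <= z -> (phi z <= phi y)%R.
  by move=> Iy Iz; apply: pm; exact/mem_set.
have smono y z : I y -> I z -> y <= z -> (- s z <= - s y)%R.
  by move=> Iy Iz; rewrite le_eqVlt lerN2 => /predU1P[->//|yz]; exact/ltW/s_lt.
have [x1 [x0 [I1 I0 x10 p10]]] : exists x1 x0, [/\ I x1, I x0, x0 < x1 & (phi x1 < phi x0)%R].
  have [uv|vu|uv] := ltgtP u v; last by move: puv; rewrite uv.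
    exists v, u; split => //; rewrite lt_neqAle pmono ?ltW// andbT.
    by apply/eqP => e; apply: puv.
  by exists u, v; split => //; rewrite lt_neqAle pmono ?ltW// andbT; exact/eqP.
have [lx xr] : l < x /\ x < r by move: Ix; rewrite /= in_itv/= => /andP[].
have [b lbx bl] := left_end_seq lx.
have Ib n : I (b n).
  by have /andP[lb bx] := lbx n; rewrite /= in_itv/= lb (lt_trans bx).
have kL' : - scale_bnd l r s r = -oo -> k = 0%R by move=> /(congr1 (@oppe R)); rewrite oppeK; exact: kL.
have pE' y : I y -> (phi y)%:E = a%:E + k%:E * ((- s y)%:E - - scale_bnd l r s r) +
    \int[mu]_(z in I) (Num.max (- s y - - s z) 0 * phi z)%:E.
  move=> Iy; rewrite pE// oppeK EFinN [X in k%:E * X]addeC; congr (_ + _).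
  by apply: eq_integral => z _; rewrite opprK [X in Num.max X _]addrC.
have s10 : (- s x1 < - s x0)%R by rewrite ltrN2; exact: s_lt.
have [n hn] := solution_unbounded k0 kL' p0 (nonincreasing_measurable smono)
  (nonincreasing_measurable pmono) pE' I1 I0 s10 p10 Ib
  (scale_unbounded_left Ix lbx bl) K.
by exists (b n); split => //; have /andP[] := lbx n.
Qed.

End scale_at_ends.

(** * The corollary *)

Unset Implicit Arguments.

Theorem corollary6p1 (R : realType) (l r : \bar R) (d : measure_display)
    (Om : measurableType d) (X : diffusion l r Om) (s : \bar R -> R)
    (m : {measure set (\bar R) -> \bar R}) (A : R -> Om -> \bar R)
    (muA : {measure set (\bar R) -> \bar R}) :
  l < r -> is_scale X s -> is_speed X s m ->
  recurrent X (fun x => law X x) ->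
  pcaf X A -> revuz X m A muA -> 0 < muA `]l, r[%classic ->
  (forall x, `]l, r[%classic x ->
    {ae law X x, forall w, A t w @[t --> +oo%R] --> +oo}) /\
  (forall (psi phi : \bar R -> R) (c1 c2 : R)
      (Q : \bar R -> probability (path_algebra X) R),
    fundamental_incr l r s muA psi ->
    fundamental_decr l r s muA phi ->
    (0 <= c1)%R -> (0 <= c2)%R -> (0 < c1 + c2)%R ->
    path_transformation (fun x => c1 * psi x + c2 * phi x)%R A Q ->
    [/\ transient X (fun x => Q x),
        c1 = 0%R -> forall x, `]l, r[%classic x -> Q x (exits_at l r X l) = 1,
        c2 = 0%R -> forall x, `]l, r[%classic x -> Q x (exits_at l r X r) = 1 &
        c1 != 0%R -> c2 != 0%R -> forall x, `]l, r[%classic x ->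
          0 < Q x (exits_at l r X r) /\ 0 < Q x (exits_at l r X l)]).
Proof.
move=> lr s_scale _ X_rec A_pcaf A_revuz muA_gt0.
split=> [x Ix|psi phi c1 c2 Q psiP phiP c1_ge0 c2_ge0 c12 gQ].
  exact: (af_infinite X_rec A_pcaf A_revuz muA_gt0 Ix).
pose g x := (c1 * psi x + c2 * phi x)%R.
have [psi0 psim _ _] := psiP; have [phi0 phim _ _] := phiP.
have psi_mono x y : `]l, r[%classic x -> `]l, r[%classic y -> x <= y -> (psi x <= psi y)%R.
  by move=> Ix Iy; apply: psim; exact/mem_set.
have phi_mono x y : `]l, r[%classic x -> `]l, r[%classic y -> x <= y -> (phi y <= phi x)%R.
  by move=> Ix Iy; apply: phim; exact/mem_set.
have g_ge0 x : `]l, r[%classic x -> (0 <= g x)%R.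
  by move=> Ix; rewrite addr_ge0// mulr_ge0 ?psi0 ?phi0.
have g_bounded a b : `]l, r[%classic a -> `]l, r[%classic b ->
    exists K, forall x, a <= x <= b -> (g x <= K)%R.
  move=> Ia Ib; exists (c1 * psi b + c2 * phi a)%R => x /andP[ax xb].
  have Ix : `]l, r[%classic x.
    move: Ia Ib; rewrite /= !in_itv/= => /andP[la _] /andP[_ br].
    by rewrite (lt_le_trans la)// (le_lt_trans xb).
  by rewrite lerD// ler_wpM2l// ?psi_mono ?phi_mono.
have start : exists x, `]l, r[%classic x.
  by have [a aP _] := left_end_seq lr; exists (a 0%N); rewrite /= in_itv/= aP.
have [x0 Ix0] := start.
have [[Bl lB] [Br rB]] := end_bases Ix0.
have ml := @limit_measurable _ _ _ _ _ X _ _ lB; have mr := @limit_measurable _ _ _ _ _ X _ _ rB.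
have mel := @exits_measurable _ _ _ _ _ X _ _ lB; have mer := @exits_measurable _ _ _ _ _ X _ _ rB.
have nIr : ~ `]l, r[%classic r by rewrite /= in_itv/= ltxx andbF.
have nIl : ~ `]l, r[%classic l by rewrite /= in_itv/= ltxx.
have inside x : `]l, r[%classic x -> l < x /\ x < r by rewrite /= in_itv/= => /andP[].
pose lim e := [set w | X t w @[t --> +oo%R] --> (e : \bar R)].
have ends x := Q_ends X_rec A_pcaf A_revuz muA_gt0 g_ge0 g_bounded gQ (x := x).
have exits_lim x e : `]l, r[%classic x -> @measurable _ (path_algebra X) (exits_at l r X e) ->
    @measurable _ (path_algebra X) (lim e) -> Q x (exits_at l r X e) = Q x (lim e).
  by move=> Ix m1 m2; apply: (@eq_measure_ae _ _ _ (Q x)) => //; exact: (exits_ae gQ e Ix).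
have full x e e' : `]l, r[%classic x -> @measurable _ (path_algebra X) (lim e) ->
    @measurable _ (path_algebra X) (lim e') ->
    (forall w, lim l w \/ lim r w -> lim e w \/ lim e' w) ->
    Q x (lim e') = 0 -> Q x (lim e) = 1.
  move=> Ix m1 m2 ee' e'0; apply/eqP; rewrite eq_le probability_le1//=.
  rewrite -[leRHS]adde0 -e'0; apply: le_trans (measureU2 _ m1 m2).
  rewrite -(probability_setT (Q x)).
  apply: (@le_measure_ae _ _ _ (Q x)) => //; first exact: (@measurableU _ (path_algebra X)).
  by apply: (ae_imp _ (ends x Ix)) => w /ee'.
split.
- exact: (Q_transient X_rec A_pcaf A_revuz muA_gt0 g_ge0 gQ Ix0).
- move=> c10 x Ix; rewrite exits_lim//; apply: (full x l r) => //.
  have [lx xr] := inside x Ix; have [b bP br] := right_end_seq xr.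
  have Ib n : `]l, r[%classic (b n).
    by have /andP[xb b_r] := bP n; rewrite /= in_itv/= b_r (lt_trans lx).
  apply: (Q_limit_null X_rec A_pcaf A_revuz muA_gt0 g_ge0 gQ Ix Ib br nIr) => // n.
    by left; exact: bP.
  have /andP[/ltW xb _] := bP n.
  by rewrite /g c10 !mul0r !add0r ler_wpM2l// phi_mono.
- move=> c20 x Ix; rewrite exits_lim//; apply: (full x r l) => //.
    by move=> w []; [right|left].
  have [lx xr] := inside x Ix; have [a aP al] := left_end_seq lx.
  have Ia n : `]l, r[%classic (a n).
    by have /andP[l_a ax] := aP n; rewrite /= in_itv/= l_a (lt_trans ax).
  apply: (Q_limit_null X_rec A_pcaf A_revuz muA_gt0 g_ge0 gQ Ix Ia al nIl) => // n.
    by right; exact: aP.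
  have /andP[_ /ltW ax] := aP n.
  by rewrite /g c20 !mul0r !addr0 ler_wpM2l// psi_mono.
- move=> c1_neq0 c2_neq0 x Ix; have [lx xr] := inside x Ix.
  have c1_gt0 : (0 < c1)%R by rewrite lt_neqAle eq_sym c1_neq0.
  have c2_gt0 : (0 < c2)%R by rewrite lt_neqAle eq_sym c2_neq0.
  split; rewrite exits_lim//.
    have [z [Iz xz zpsi]] := fundamental_incr_unbounded X_rec s_scale psiP Ix (g x / c1)%R.
    apply: (Q_limit_pos X_rec A_pcaf A_revuz muA_gt0 g_ge0 g_bounded gQ (z := z) (e' := l)) => //.
    - by move=> w []; [right|left].
    - by right; rewrite lx.
    - rewrite ltr_pdivrMr// mulrC in zpsi; apply: lt_le_trans zpsi _.
      by rewrite lerDl mulr_ge0// phi0.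
  have [z [Iz zx zphi]] := fundamental_decr_unbounded X_rec s_scale phiP Ix (g x / c2)%R.
  apply: (Q_limit_pos X_rec A_pcaf A_revuz muA_gt0 g_ge0 g_bounded gQ (z := z) (e' := r)) => //.
  - by left; rewrite zx.
  - rewrite ltr_pdivrMr// mulrC in zphi; apply: lt_le_trans zphi _.
    by rewrite lerDr mulr_ge0// psi0.
Qed.
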